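(* Let $n\ge1$, let $\lambda$ be a partition of $n$, and let $(\alpha,\beta)$ be a pair of partitions with $|\alpha|+|\beta|=n$, all parts of $\alpha$ odd and all parts of $\beta$ even. Then the character value (trace) of the simple $\mathbb{C}B_n^-$-module $B^\lambda$ at the canonical (even split) element of type $(\alpha,\beta)$ in $\mathbb{C}B_n^-$ is $$\begin{cases}2^{\ell(\alpha\cup\beta)/2}\,(-1)^{(n-\ell(\alpha))/2}\,\chi^\lambda_{\alpha\cup\beta}&\text{if }n\text{ is even},\\[2pt]2^{(\ell(\alpha\cup\beta)+1)/2}\,(-1)^{(n-\ell(\alpha))/2}\,\chi^\lambda_{\alpha\cup\beta}&\text{if }n\text{ is odd}.\end{cases}$$
   Context: $\ell(\cdot)$ is the number of parts, $\alpha\cup\beta$ is the partition obtained by collecting the parts of $\alpha$ and $\beta$, and $\chi^\lambda_\mu$ is the character value of the Specht module $S^\lambda$ (with $S^{(n)}$ trivial) on permutations of cycle type $\mu$. $\mathbb{C}B_n^-$ is the superalgebra over $\mathbb{C}$ with odd generators $t_1,\dots,t_n$ and relations $t_i^2=1$; $t_it_{i+1}t_i=t_{i+1}t_it_{i+1}$ ($1\le i\le n-2$); $(t_it_j)^2=-1$ ($|i-j|>1$); $(t_{n-1}t_n)^4=-1$. $\mathcal{C}l_n$ is the Clifford superalgebra with odd generators $c_1,\dots,c_n$, $c_i^2=1$, $c_ic_j=-c_jc_i$ ($i\ne j$); $U$ is its unique simple $\mathbb{Z}_2$-graded module ($\dim U=2^k$ for $n=2k$ or $n=2k-1$). There is a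 superalgebra isomorphism $\phi^B:\mathbb{C}B_n^-\to\mathcal{C}l_n\otimes\mathbb{C}S_n$ ($\mathbb{C}S_n$ purely even), $t_i\mapsto\frac1{\sqrt2}(c_i-c_{i+1})s_i$ ($i<n$), $t_n\mapsto c_n$, and $B^\lambda$ is the pullback of $U\otimes S^\lambda$ via $\phi^B$. Canonical elements: put $b_n=t_n$ and $b_i=t_ib_{i+1}t_i$ for $1\le i\le n-1$. The canonical positive cycle permuting $a,\dots,a+k$ is $t_at_{a+1}\cdots t_{a+k-1}$; the canonical negative cycle permuting $a,\dots,a+k$ is $t_at_{a+1}\cdots t_{a+k-1}b_{a+k}$. The canonical element of type $(\alpha,\beta)$ is the product of canonical positive cycles of lengths the parts of $\alpha$ and canonical negative cycles of lengths the parts of $\beta$, supported on consecutive disjoint intervals partitioning $\{1,\dots,n\}$, with the intervals of all negative cycles to the right of (i.e. consisting of bigger numbers than) those of all positive cycles. *)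

(* Defs.v *)
From HB Require Import structures.
From mathcomp Require Import all_boot all_order all_fingroup all_algebra.
From mathcomp Require Import mxrepresentation.
From mathcomp Require Import boolp reals.
From mathcomp Require Import complex mxtens.

Set Implicit Arguments.
Unset Strict Implicit.
Unset Printing Implicit Defensive.

Import Order.TTheory GRing.Theory Num.Theory.
Local Open Scope ring_scope.

(* A unital associative F-algebra, as a ring with a central ring morphism from
   F. Here 1 = 0 is allowed, so that 'M_0 and every presented algebra qualify;
   algType excludes them. *)
Record algebra (F : comNzRingType) := Algebra {
  alg_ring :> pzRingType;
  alg_scalar : {rmorphism F -> alg_ring};
  alg_scalarC : forall a x, alg_scalar a * x = x * alg_scalar a
}.

Arguments alg_scalar {F} _.
Notation "a %:S" := (alg_scalar _ a) (at level 2, left associativity, format "a %:S") : ring_scope.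

Record alg_morphism (F : comNzRingType) (A B : algebra F) := AlgMorphism {
  alg_fun :> {rmorphism A -> B};
  alg_fun_scalar : forall a, alg_fun a%:S = a%:S
}.

Definition alg_comp (F : comNzRingType) (A B D : algebra F)
    (g : alg_morphism B D) (f : alg_morphism A B) : alg_morphism A D.
Proof.
exists (GRing.RMorphism.clone _ _ (g \o f) _) => a /=.
by rewrite !alg_fun_scalar.
Defined.

Definition mxalg (F : comNzRingType) d : algebra F :=
  @Algebra F 'M[F]_d (GRing.RMorphism.clone _ _ (@scalar_mx F d) _)
    (fun a x => esym (scalar_mxC a x)).

Inductive term (F I : Type) : Type :=
  | TGen of I
  | TCst of F
  | TAdd of term F I & term F I
  | TMul of term F I & term F I.

Arguments TGen {F I}.
Arguments TCst {F I}.

Declare Scope term_scope.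
Delimit Scope term_scope with tm.
Bind Scope term_scope with term.
Notation "x + y" := (TAdd x y) : term_scope.
Notation "x * y" := (TMul x y) : term_scope.
Notation "- x" := (TMul (TCst (-1)%R) x) : term_scope.
Notation "a %:C" := (TCst a%R) : term_scope.

Definition texp (F : pzRingType) I (x : term F I) k := iterop k (@TMul F I) x (TCst 1).
Notation "x ^+ k" := (texp x k) : term_scope.

(* The least congruence containing the relations r and the axioms of
   F-algebras. *)
Inductive tcongr (F : comNzRingType) I (r : term F I -> term F I -> Prop) :
    term F I -> term F I -> Prop :=
  | tc_rel x y : r x y -> tcongr r x y
  | tc_refl x : tcongr r x x
  | tc_sym x y : tcongr r x y -> tcongr r y x
  | tc_trans x y z : tcongr r x y -> tcongr r y z -> tcongr r x z
  | tc_add x x' y y' :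
      tcongr r x x' -> tcongr r y y' -> tcongr r (x + y)%tm (x' + y')%tm
  | tc_mul x x' y y' :
      tcongr r x x' -> tcongr r y y' -> tcongr r (x * y)%tm (x' * y')%tm
  | tc_addA x y z : tcongr r (x + (y + z))%tm (x + y + z)%tm
  | tc_addC x y : tcongr r (x + y)%tm (y + x)%tm
  | tc_add0 x : tcongr r (0%:C + x)%tm x
  | tc_addN x : tcongr r (- x + x)%tm 0%:C%tm
  | tc_mulA x y z : tcongr r (x * (y * z))%tm (x * y * z)%tm
  | tc_mul1l x : tcongr r (1%:C * x)%tm x
  | tc_mul1r x : tcongr r (x * 1%:C)%tm x
  | tc_mulDl x y z : tcongr r ((x + y) * z)%tm (x * z + y * z)%tm
  | tc_mulDr x y z : tcongr r (x * (y + z))%tm (x * y + x * z)%tm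
  | tc_cstD a b : tcongr r (a + b)%:C%tm (a%:C + b%:C)%tm
  | tc_cstM a b : tcongr r (a * b)%:C%tm (a%:C * b%:C)%tm
  | tc_cstC a x : tcongr r (a%:C * x)%tm (x * a%:C)%tm.

Section PresentedAlgebra.
Variables (F : comNzRingType) (I : Type) (r : term F I -> term F I -> Prop).

Local Notation T := {classic (term F I)}.

Definition tcongrb : rel T := fun x y => `[< tcongr r x y >].

Fact tcongrb_refl : reflexive tcongrb.
Proof. by move=> x; apply/asboolP; exact: tc_refl. Qed.
Fact tcongrb_sym : symmetric tcongrb.
Proof.
by move=> x y; apply/asboolP/asboolP; exact: tc_sym.
Qed.
Fact tcongrb_trans : transitive tcongrb.
Proof.
by move=> y x z /asboolP xy /asboolP yz; apply/asboolP; exact: tc_trans yz.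
Qed.

Canonical tcongr_equiv := EquivRel tcongrb tcongrb_refl tcongrb_sym tcongrb_trans.

Definition presring : Type := {eq_quot tcongr_equiv}%qT.
HB.instance Definition _ := Choice.on presring.

Definition pcls (x : term F I) : presring := (\pi_{eq_quot tcongr_equiv} (x : T))%qT.
Definition prep (u : presring) : term F I := (generic_quotient.repr (u : {eq_quot tcongr_equiv}%qT) : T).

Lemma prepK u : pcls (prep u) = u.
Proof. exact: reprK. Qed.

Lemma pclsP x y : pcls x = pcls y <-> tcongr r x y.
Proof.
split=> [/eqmodP/asboolP //|xy]; apply/eqmodP; exact/asboolP.
Qed.

Lemma prep_pcls x : tcongr r (prep (pcls x)) x.
Proof. by apply/pclsP; rewrite prepK. Qed.

Definition padd u v := pcls (prep u + prep v)%tm.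
Definition pmul u v := pcls (prep u * prep v)%tm.
Definition popp u := pcls (- prep u)%tm.

Lemma paddE x y : padd (pcls x) (pcls y) = pcls (x + y)%tm.
Proof. by apply/pclsP/tc_add; exact: prep_pcls. Qed.
Lemma pmulE x y : pmul (pcls x) (pcls y) = pcls (x * y)%tm.
Proof. by apply/pclsP/tc_mul; exact: prep_pcls. Qed.
Lemma poppE x : popp (pcls x) = pcls (- x)%tm.
Proof. by apply/pclsP/tc_mul; [exact: tc_refl | exact: prep_pcls]. Qed.
Lemma pind (P : presring -> Prop) : (forall x, P (pcls x)) -> forall u, P u.
Proof. by move=> h u; rewrite -(prepK u). Qed.

Fact paddA : associative padd.
Proof.
elim/pind=> x; elim/pind=> y; elim/pind=> z.
by rewrite !paddE; apply/pclsP; constructor.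
Qed.
Fact paddC : commutative padd.
Proof.
by elim/pind=> x; elim/pind=> y; rewrite !paddE; apply/pclsP; constructor.
Qed.
Fact padd0 : left_id (pcls 0%:C) padd.
Proof. by elim/pind=> x; rewrite paddE; apply/pclsP; constructor. Qed.
Fact paddN : left_inverse (pcls 0%:C) popp padd.
Proof. by elim/pind=> x; rewrite poppE paddE; apply/pclsP; constructor. Qed.
Fact pmulA : associative pmul.
Proof.
elim/pind=> x; elim/pind=> y; elim/pind=> z.
by rewrite !pmulE; apply/pclsP; constructor.
Qed.
Fact pmul1l : left_id (pcls 1%:C) pmul.
Proof. by elim/pind=> x; rewrite pmulE; apply/pclsP; constructor. Qed.
Fact pmul1r : right_id (pcls 1%:C) pmul.
Proof. by elim/pind=> x; rewrite pmulE; apply/pclsP; constructor. Qed.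
Fact pmulDl : left_distributive pmul padd.
Proof.
elim/pind=> x; elim/pind=> y; elim/pind=> z.
by rewrite !(pmulE, paddE); apply/pclsP; constructor.
Qed.
Fact pmulDr : right_distributive pmul padd.
Proof.
elim/pind=> x; elim/pind=> y; elim/pind=> z.
by rewrite !(pmulE, paddE); apply/pclsP; constructor.
Qed.

HB.instance Definition _ := GRing.isPzRing.Build presring
  paddA paddC padd0 paddN pmulA pmul1l pmul1r pmulDl pmulDr.

Definition pcst (a : F) : presring := pcls a%:C.

Fact pcst_zmod_morphism : zmod_morphism pcst.
Proof.
move=> a b; change (pcls (a - b)%:C = padd (pcst a) (popp (pcst b))).
rewrite poppE paddE; apply/pclsP; apply: tc_trans (tc_cstD _ _ _) _.
by apply: tc_add (tc_refl _ _) _; rewrite -(mulN1r b); constructor.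
Qed.
Fact pcst_monoid_morphism : monoid_morphism pcst.
Proof.
split=> // a b; change (pcls (a * b)%:C = pmul (pcst a) (pcst b)).
by rewrite pmulE; apply/pclsP; constructor.
Qed.
HB.instance Definition _ :=
  GRing.isZmodMorphism.Build F presring pcst pcst_zmod_morphism.
HB.instance Definition _ :=
  GRing.isMonoidMorphism.Build F presring pcst pcst_monoid_morphism.

Fact pcstC (a : F) (u : presring) : pcst a * u = u * pcst a.
Proof.
elim/pind: u => x.
change (pmul (pcls a%:C) (pcls x) = pmul (pcls x) (pcls a%:C)).
by rewrite !pmulE; apply/pclsP; constructor.
Qed.

Definition presalg : algebra F := Algebra pcstC.

Definition pgen (i : I) : presalg := pcls (TGen i).

Section Lift.
Variables (A : algebra F) (f : I -> A).

Fixpoint teval (x : term F I) : A :=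
  match x with
  | TGen i => f i
  | TCst a => a%:S
  | TAdd x y => teval x + teval y
  | TMul x y => teval x * teval y
  end.

Definition respects := forall x y, r x y -> teval x = teval y.

Lemma teval_congr : respects -> forall x y, tcongr r x y -> teval x = teval y.
Proof.
move=> rf x y; elim=> {x y} /=.
- exact: rf.
- by [].
- by [].
- by move=> x y z _ -> _ ->.
- by move=> x x' y y' _ -> _ ->.
- by move=> x x' y y' _ -> _ ->.
- by move=> x y z; rewrite addrA.
- by move=> x y; rewrite addrC.
- by move=> x; rewrite rmorph0 add0r.
- by move=> x; rewrite rmorphN1 mulN1r addNr rmorph0.
- by move=> x y z; rewrite mulrA.
- by move=> x; rewrite rmorph1 mul1r.
- by move=> x; rewrite rmorph1 mulr1.
- by move=> x y z; rewrite mulrDl.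
- by move=> x y z; rewrite mulrDr.
- by move=> a b; rewrite rmorphD.
- by move=> a b; rewrite rmorphM.
- by move=> a x; rewrite alg_scalarC.
Qed.

Hypothesis rf : respects.

Definition plift_fun (u : presring) : A := teval (prep u).

Lemma plift_funE x : plift_fun (pcls x) = teval x.
Proof. by apply: (teval_congr rf); exact: prep_pcls. Qed.

Fact plift_zmod_morphism : zmod_morphism plift_fun.
Proof.
elim/pind=> x; elim/pind=> y.
change (plift_fun (padd (pcls x) (popp (pcls y))) =
        plift_fun (pcls x) - plift_fun (pcls y)).
by rewrite poppE paddE !plift_funE /= rmorphN1 mulN1r.
Qed.
Fact plift_monoid_morphism : monoid_morphism plift_fun.
Proof.
split; first by change (plift_fun (pcls 1%:C) = 1); rewrite plift_funE /= rmorph1.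
elim/pind=> x; elim/pind=> y.
change (plift_fun (pmul (pcls x) (pcls y)) =
        plift_fun (pcls x) * plift_fun (pcls y)).
by rewrite pmulE !plift_funE.
Qed.

(* Universal property: the algebra morphism that extends f. *)
Definition plift : alg_morphism presalg A.
Proof.
pose m1 := GRing.isZmodMorphism.Build presring A plift_fun plift_zmod_morphism.
pose m2 := GRing.isMonoidMorphism.Build presring A plift_fun plift_monoid_morphism.
pose g : {rmorphism presring -> A} := HB.pack plift_fun m1 m2.
by exists g => a; exact: plift_funE.
Defined.

Lemma plift_gen i : plift (pgen i) = f i.
Proof. exact: plift_funE. Qed.

End Lift.

Lemma pcls_teval x : pcls x = teval pgen x.
Proof.
elim: x => [i|a|x IHx y IHy|x IHx y IHy] //=.
- by rewrite -IHx -IHy; apply/esym/paddE.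
- by rewrite -IHx -IHy; apply/esym/pmulE.
Qed.

Lemma presalg_rel x y : r x y -> teval pgen x = teval pgen y.
Proof. by move=> rxy; rewrite -!pcls_teval; apply/pclsP/tc_rel. Qed.

End PresentedAlgebra.

Lemma teval_exp (F : comNzRingType) I (A : algebra F) (f : I -> A) x k :
  teval f (x ^+ k)%tm = teval f x ^+ k.
Proof.
rewrite /texp; case: k => [|k] /=; first by rewrite rmorph1.
by elim: k => //= k ->; rewrite -exprS.
Qed.

(* The tensor product of A and B: generated by copies of A and B that commute
   with each other. It is also the super tensor product of a superalgebra A and
   a purely even B, since no sign arises then. *)
Section TensorProduct.
Variables (F : comNzRingType) (A B : algebra F).

Inductive tens_rel : term F (A + B) -> term F (A + B) -> Prop :=
  | tens_lD (x y : A) : tens_rel (TGen (inl (x + y)))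
                                 (TGen (inl x) + TGen (inl y))%tm
  | tens_lM (x y : A) : tens_rel (TGen (inl (x * y)))
                                 (TGen (inl x) * TGen (inl y))%tm
  | tens_lS a : tens_rel (TGen (inl a%:S)) a%:C%tm
  | tens_rD (x y : B) : tens_rel (TGen (inr (x + y)))
                                 (TGen (inr x) + TGen (inr y))%tm
  | tens_rM (x y : B) : tens_rel (TGen (inr (x * y)))
                                 (TGen (inr x) * TGen (inr y))%tm
  | tens_rS a : tens_rel (TGen (inr a%:S)) a%:C%tm
  | tens_C (x : A) (y : B) : tens_rel (TGen (inl x) * TGen (inr y))%tm
                                      (TGen (inr y) * TGen (inl x))%tm.

Definition tens : algebra F := presalg tens_rel.
Definition tensl (x : A) : tens := pgen tens_rel (inl x).
Definition tensr (y : B) : tens := pgen tens_rel (inr y).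

Lemma tenslD x y : tensl (x + y) = tensl x + tensl y.
Proof. exact: (presalg_rel (tens_lD x y)). Qed.
Lemma tenslM x y : tensl (x * y) = tensl x * tensl y.
Proof. exact: (presalg_rel (tens_lM x y)). Qed.
Lemma tenslS a : tensl a%:S = a%:S.
Proof. exact: (presalg_rel (tens_lS a)). Qed.
Lemma tensrD x y : tensr (x + y) = tensr x + tensr y.
Proof. exact: (presalg_rel (tens_rD x y)). Qed.
Lemma tensrM x y : tensr (x * y) = tensr x * tensr y.
Proof. exact: (presalg_rel (tens_rM x y)). Qed.
Lemma tensrS a : tensr a%:S = a%:S.
Proof. exact: (presalg_rel (tens_rS a)). Qed.
Lemma tenslr x y : tensl x * tensr y = tensr y * tensl x.
Proof. exact: (presalg_rel (tens_C x y)). Qed.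

End TensorProduct.

(* The tensor product of a d-dimensional A-module and an e-dimensional
   B-module, as a module over the tensor product of A and B. *)
Section TensorRepr.
Variables (F : comNzRingType) (A B : algebra F) (d e : nat).
Variables (rho : alg_morphism A (mxalg F d)) (sigma : alg_morphism B (mxalg F e)).

Definition tens_repr_gen (z : A + B) : mxalg F (d * e) :=
  match z with
  | inl x => (rho x : 'M_d) *t 1%:M
  | inr y => 1%:M *t (sigma y : 'M_e)
  end.

Fact tens_repr_respects : respects (@tens_rel F A B) tens_repr_gen.
Proof.
have tDl m n (X Y : 'M[F]_m) (Z : 'M[F]_n) : (X + Y) *t Z = X *t Z + Y *t Z.
  by apply/matrixP=> i j; rewrite !mxE mulrDl.
have tDr m n (X Y : 'M[F]_m) (Z : 'M[F]_n) : Z *t (X + Y) = Z *t X + Z *t Y.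
  by apply/matrixP=> i j; rewrite !mxE mulrDr.
have tM m n (X Y : 'M[F]_m) (Z W : 'M[F]_n) :
    (X *m Y) *t (Z *m W) = (X *t Z) *m (Y *t W) by rewrite tensmx_mul.
have tS m n (a b : F) : (a%:M : 'M[F]_m) *t (b%:M : 'M[F]_n) = (a * b)%:M.
  apply/matrixP=> i j.
  case: (mxtens_indexP i) => i0 i1; case: (mxtens_indexP j) => j0 j1.
  rewrite tensmxE !mxE (can_eq (@mxtens_indexK m n)) xpair_eqE.
  by rewrite mulrnAl mulrnAr -mulrnA mulnb andbC.
move=> _ _ [x y|x y|a|x y|x y|a|x y] /=.
- by rewrite rmorphD tDl.
- by rewrite rmorphM -[X in _ *t X](mul1mx 1%:M) tM.
- by rewrite alg_fun_scalar tS mulr1.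
- by rewrite rmorphD tDr.
- by rewrite rmorphM -[X in X *t _](mul1mx 1%:M) tM.
- by rewrite alg_fun_scalar tS mul1r.
- by rewrite -[LHS]tM -[RHS]tM !mul1mx !mulmx1.
Qed.

Definition tens_repr : alg_morphism (tens A B) (mxalg F (d * e)) :=
  plift tens_repr_respects.

End TensorRepr.

Section GroupAlgebra.
Variables (F : comNzRingType) (gT : finGroupType).

Inductive grp_rel : term F gT -> term F gT -> Prop :=
  | grp_M g h : grp_rel (TGen (g * h)%g) (TGen g * TGen h)%tm
  | grp_1 : grp_rel (TGen 1%g) 1%:C%tm.

Definition grpalg : algebra F := presalg grp_rel.
Definition grp (g : gT) : grpalg := pgen grp_rel g.

Lemma grpM g h : grp (g * h)%g = grp g * grp h.
Proof. exact: (presalg_rel (grp_M g h)). Qed.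
Lemma grp1 : grp 1%g = 1.
Proof. by rewrite [LHS](presalg_rel grp_1) /= rmorph1. Qed.

End GroupAlgebra.

Section GroupAlgebraRepr.
Variables (F : fieldType) (gT : finGroupType) (d : nat).
Variable rG : mx_representation F [set: gT] d.

Fact grpalg_repr_respects :
  respects (@grp_rel F gT) (fun g => rG g : mxalg F d).
Proof.
move=> _ _ [g h|] /=; first by rewrite repr_mxM ?inE.
by rewrite repr_mx1 rmorph1.
Qed.

Definition grpalg_repr : alg_morphism (grpalg F gT) (mxalg F d) :=
  plift grpalg_repr_respects.

End GroupAlgebraRepr.

(* Specht modules. The entries of a tableau of shape lam are 0, ..., n - 1 and t
   is the tableau filled with them row after row, so that the entry i lies in
   the row reshape_index lam i and the column reshape_offset lam i. Permutations
   act on the right: t g is obtained by replacing each entry i by g i. In the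
   regular representation the tabloid {t g} is modelled by the sum of the p * g
   for p in the row stabilizer, whose span as g varies is the permutation module
   on tabloids; the Specht module is generated by the polytabloid of t, the sum
   of the (-1) ^+ q {t q} for q in the column stabilizer. Below, matrices act on
   columns, which turns this right module (on rows) into the dual left module;
   the two have the same character, as w and w^-1 are conjugate. *)
Section Specht.
Variables (F : fieldType) (n : nat) (lam : seq nat).

Definition row_stab : {set 'S_n} :=
  [set p : 'S_n | [forall i, reshape_index lam (p i) == reshape_index lam i]].
Definition col_stab : {set 'S_n} :=
  [set q : 'S_n | [forall i, reshape_offset lam (q i) == reshape_offset lam i]].

Local Notation regS := (regular_repr F [set: 'S_n]).

Definition tabloid (g : 'S_n) : 'rV[F]_#|[set: 'S_n]| :=
  gring_row (\sum_(p in row_stab) regS (p * g)%g).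
Definition polytabloid : 'rV[F]_#|[set: 'S_n]| :=
  \sum_(q in col_stab) (-1) ^+ q *: tabloid q.

Definition specht_mx := cyclic_mx regS polytabloid.
Definition specht_repr : mx_representation F [set: 'S_n] (\rank specht_mx) :=
  submod_repr (cyclic_mx_module regS polytabloid).

Definition specht_char (w : 'S_n) : F := \tr (specht_repr w).

End Specht.

(* Indices are shifted by one: t_1, ..., t_n are sgen 0, ..., sgen (n - 1),
   and likewise for the other families. *)
Section SpinB.
Variables (F : comNzRingType) (n : nat).

Inductive clif_rel : term F 'I_n -> term F 'I_n -> Prop :=
  | clif_sq i : clif_rel (TGen i ^+ 2)%tm 1%:C%tm
  | clif_anti i j : i != j ->
      clif_rel (TGen i * TGen j)%tm (- (TGen j * TGen i))%tm.

Definition clif : algebra F := presalg clif_rel.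
Definition cgen (i : 'I_n) : clif := pgen clif_rel i.

Inductive spin_rel : term F 'I_n -> term F 'I_n -> Prop :=
  | spin_sq i : spin_rel (TGen i ^+ 2)%tm 1%:C%tm
  | spin_braid (i j : 'I_n) : j = i.+1 :> nat -> (j.+1 < n)%N ->
      spin_rel (TGen i * TGen j * TGen i)%tm (TGen j * TGen i * TGen j)%tm
  | spin_far (i j : 'I_n) : (i.+1 < j)%N || (j.+1 < i)%N ->
      spin_rel ((TGen i * TGen j) ^+ 2)%tm (-1)%:C%tm
  | spin_last (i j : 'I_n) : j = i.+1 :> nat -> j.+1 = n ->
      spin_rel ((TGen i * TGen j) ^+ 4)%tm (-1)%:C%tm.

Definition spinB : algebra F := presalg spin_rel.
Definition sgen (i : 'I_n) : spinB := pgen spin_rel i.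

Lemma cgen_sq i : cgen i * cgen i = 1.
Proof.
by have := presalg_rel (clif_sq i); rewrite teval_exp expr2 /= rmorph1.
Qed.

Lemma cgen_anti i j : i != j -> cgen i * cgen j = - (cgen j * cgen i).
Proof.
by move=> ij; have := presalg_rel (clif_anti ij); rewrite /= rmorphN1 mulN1r.
Qed.

End SpinB.

(* Z/2-graded clif-modules, on column vectors. As the generators of clif are
   odd, a grading is an involution (1 on the even part and -1 on the odd part)
   that anticommutes with the action of each generator. *)
Record clif_supermodule (F : comNzRingType) n := ClifSupermodule {
  sm_dim : nat;
  sm_repr : alg_morphism (clif F n) (mxalg F sm_dim);
  sm_parity : 'M[F]_sm_dim;
  sm_parity_sq : sm_parity *m sm_parity = 1%:M;
  sm_parity_odd : forall i, sm_parity *m sm_repr (cgen F i) =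
                            - ((sm_repr (cgen F i) : 'M_sm_dim) *m sm_parity)
}.

(* A graded submodule is the span of the columns of V^T, that is, of the
   transposes of the rows of V. *)
Definition simple_supermodule (F : fieldType) n (U : clif_supermodule F n) :=
  (0 < sm_dim U)%N /\
  forall V : 'M[F]_(sm_dim U),
    (forall x : clif F n, stablemx V (sm_repr U x : 'M_(sm_dim U))^T) ->
    stablemx V (sm_parity U)^T ->
  V = 0 \/ row_full V.

Section ReflectionIdentities.
Variables (C : numClosedFieldType) (A : algebra C).
Implicit Types x y a b : A.

Let k : A := (sqrtC 2)^-1%:S.

Local Fact kC x : x * k = k * x.
Proof. by rewrite alg_scalarC. Qed.

Local Fact kk x : k * (k * x) *+ 2 = x.
Proof.
rewrite mulrA -rmorphM -mulr_natl -(rmorph_nat (alg_scalar A)) mulrA -rmorphM.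
by rewrite -expr2 exprVn sqrtCK mulfV ?rmorph1 ?mul1r // pnatr_eq0.
Qed.

Local Fact double_inj : injective (fun x => x *+ 2).
Proof.
move=> x y; rewrite -[x *+ 2]mulr_natl -[y *+ 2]mulr_natl.
rewrite -(rmorph_nat (alg_scalar A)) => /(congr1 ( *%R (2%:R^-1%:S))).
by rewrite !mulrA -rmorphM mulVf ?rmorph1 ?mul1r // pnatr_eq0.
Qed.

Local Fact kM x y : k * x * (k * y) *+ 2 = x * y.
Proof. by rewrite -mulrA (mulrA x) kC -mulrA kk. Qed.

Section TwoGen.
Variables a b : A.
Hypotheses (aa : a * a = 1) (bb : b * b = 1) (ab : a * b = - (b * a)).

Fact refl_sq : (k * (a - b)) * (k * (a - b)) = 1.
Proof.
apply: double_inj => /=; rewrite kM mulrBl !mulrBr aa bb ab.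
by rewrite opprB opprK addrACA subrr addr0 mulr2n.
Qed.

Local Fact refl_b_sum : (k * (a - b)) * b + b * (k * (a - b)) = - (k *+ 2).
Proof.
rewrite mulrA kC -!mulrA -mulrDr mulrBl mulrBr bb ab addrAC.
by rewrite addrA addNr sub0r -opprD mulrN -mulr2n mulrnAr mulr1.
Qed.

Fact refl_last : ((k * (a - b)) * b) ^+ 4 = -1.
Proof.
set w := _ * b; set v := b * (k * (a - b)).
have wv : w * v = 1 by rewrite /w /v -mulrA (mulrA b b) bb mul1r refl_sq.
have : w + v = - (k *+ 2) by exact: refl_b_sum.
have : (k *+ 2) * (k *+ 2) = 2.
  by rewrite mulrnAl mulrnAr; congr (_ *+ 2); rewrite -{2}[k]mulr1 kk.
have : w * (k *+ 2) = (k *+ 2) * w by rewrite mulrnAl mulrnAr kC.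
move: (k *+ 2) => K wK KK sE.
have ww : w * w = - (K * w + 1).
  by rewrite -[LHS](addrK 1) -{1}wv -mulrDr sE mulrN wK opprD.
have zz : (K * w) * (K * w) = - ((K * w + 1) *+ 2).
  by rewrite -mulrA (mulrA w) wK -mulrA mulrA KK ww mulrN mulr_natl.
have -> : w ^+ 4 = (w * w) * (w * w) by rewrite !exprS expr0 mulr1 !mulrA.
rewrite ww mulrNN mulrDl mulrDr mul1r mulr1 zz -addrA.
rewrite (addrA (K * w)) -mulr2n mulrnDl opprD addrACA addNr add0r.
by rewrite mulr2n opprD addrNK.
Qed.
End TwoGen.

Fact anti_far x y : x * x = 1 -> y * y = 1 -> x * y = - (y * x) ->
  (x * y) ^+ 2 = -1.
Proof.
by move=> xx yy xy; rewrite expr2 {1}xy mulNr -mulrA (mulrA x) xx mul1r yy.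
Qed.

Fact anti_refl x a b : a * x = - (x * a) -> b * x = - (x * b) ->
  (k * (a - b)) * x = - (x * (k * (a - b))).
Proof.
move=> ax bx; rewrite (mulrA x) kC -!mulrA -mulrN; congr (_ * _).
by rewrite mulrBl mulrBr ax bx opprB opprK addrC.
Qed.

Local Fact zmod_aux (p q r u : A) :
  - p - - q - (u - - r) + (p - u - (q - r)) = (- u) *+ 2.
Proof.
rewrite !opprK addrACA.
have -> : - p + q + (p - u) = q - u by rewrite [- p + q]addrC addrA addrNK.
have -> : - (u + r) - (q - r) = - q - u.
  by rewrite opprB opprD addrA addrNK addrC.
by rewrite addrACA subrr add0r mulr2n.
Qed.

Fact refl_braid a b c : a * a = 1 -> b * b = 1 -> c * c = 1 ->
  a * b = - (b * a) -> b * c = - (c * b) -> a * c = - (c * a) ->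
  (k * (a - b)) * (k * (b - c)) * (k * (a - b)) =
  (k * (b - c)) * (k * (a - b)) * (k * (b - c)).
Proof.
move=> aa bb cc ab bc ac.
have xx : (k * (a - b)) * (k * (a - b)) = 1 by exact: refl_sq.
have yy : (k * (b - c)) * (k * (b - c)) = 1 by exact: refl_sq.
have xy : (k * (a - b)) * (k * (b - c)) + (k * (b - c)) * (k * (a - b)) = - 1.
  apply: double_inj => /=; rewrite mulrnDl !kM !mulrBl !mulrBr bb ab bc ac.
  exact: zmod_aux.
move: xx yy xy; set x := k * (a - b); set y := k * (b - c) => xx yy xy.
have -> : x * y * x = - x - y.
  have yx : y * x = - 1 - x * y by rewrite -xy addrC addKr.
  by rewrite -mulrA yx mulrBr mulrN1 mulrA xx mul1r.
have yx : y * x = - 1 - x * y by rewrite -xy addrC addKr.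
by rewrite yx mulrBl mulN1r -mulrA yy mulr1 addrC.
Qed.
End ReflectionIdentities.


Section PhiB.
Variables (C : numClosedFieldType) (n : nat).

Local Notation target := (tens (clif C n) (grpalg C 'S_n)).

(* ordS i is i + 1 where it is used. *)
Definition phiB_gen (i : 'I_n) : target :=
  if (i.+1 < n)%N then
    tensl _ ((sqrtC 2)^-1%:S * (cgen C i - cgen C (ordS i)))
      * tensr _ (grp C (tperm i (ordS i)))
  else tensl _ (cgen C i).

Let cl (i : 'I_n) : clif C n :=
  if (i.+1 < n)%N then (sqrtC 2)^-1%:S * (cgen C i - cgen C (ordS i))
  else cgen C i.
Let tr (i : 'I_n) : 'S_n := if (i.+1 < n)%N then tperm i (ordS i) else 1%g.
Let ts (x : clif C n) (g : 'S_n) : target := tensl _ x * tensr _ (grp C g).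

Let phiB_genE i : phiB_gen i = ts (cl i) (tr i).
Proof.
rewrite /phiB_gen /ts /cl /tr; case: ifP => // _.
have -> : grp C (1%g : 'S_n) = 1%:S by rewrite grp1 rmorph1.
by rewrite tensrS rmorph1 mulr1.
Qed.

Let tsM x y g h : ts x g * ts y h = ts (x * y) (g * h)%g.
Proof.
rewrite /ts grpM tenslM tensrM -!mulrA; congr (_ * _).
by rewrite !mulrA; congr (_ * _); rewrite tenslr.
Qed.

Let tsS a : ts a%:S 1%g = a%:S.
Proof.
rewrite /ts; have -> : grp C (1%g : 'S_n) = 1%:S by rewrite grp1 rmorph1.
by rewrite tensrS tenslS rmorph1 mulr1.
Qed.

Let tsX x g m : ts x g ^+ m = ts (x ^+ m) (g ^+ m)%g.
Proof.
elim: m => [|m IHm]; last by rewrite !exprS expgS IHm tsM.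
rewrite !expr0 expg0; have -> : (1 : clif C n) = 1%:S by rewrite rmorph1.
by rewrite tsS rmorph1.
Qed.

Let tsN1 : ts (-1) 1%g = -1.
Proof.
have -> : (-1 : clif C n) = (-1)%:S by rewrite rmorphN1.
by rewrite tsS rmorphN1.
Qed.

Let ordSE (i : 'I_n) : (i.+1 < n)%N -> ordS i = i.+1 :> nat.
Proof. by move=> lt_i; rewrite /= modn_small. Qed.

Let neqS (i : 'I_n) : (i.+1 < n)%N -> i != ordS i.
Proof.
move=> lt_i; apply/eqP=> e; have := ordSE lt_i; rewrite -e => /eqP.
by rewrite ltn_eqF.
Qed.

Let cl_sq i : cl i * cl i = 1.
Proof.
rewrite /cl; case: ifP => lt_i; last exact: cgen_sq.
by apply: refl_sq; rewrite ?cgen_sq //; apply/cgen_anti/neqS.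
Qed.

Let tr_sq i : (tr i * tr i = 1)%g.
Proof. by rewrite /tr; case: ifP => _; rewrite ?tperm2 ?mulg1. Qed.

Let cl_anti_gen i (j : 'I_n) : (i != j) -> ((i.+1 < n)%N -> ordS i != j) ->
  cl i * cgen C j = - (cgen C j * cl i).
Proof.
rewrite /cl => ij; case: ifP => [lt_i /(_ isT) Sij|_ _]; last exact: cgen_anti.
by apply: anti_refl; exact: cgen_anti.
Qed.

Let cl_far (i j : 'I_n) : (i.+1 < j)%N -> cl i * cl j = - (cl j * cl i).
Proof.
move=> ij; have lt_i : (i.+1 < n)%N by exact: ltn_trans ij (ltn_ord j).
have antij (m : 'I_n) : (j <= m)%N -> cl i * cgen C m = - (cgen C m * cl i).
  move=> jm; apply: cl_anti_gen => [|_]; apply/eqP=> e.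
    by move: ij; rewrite e ltnNge (leq_trans jm).
  by move: (ordSE lt_i); rewrite e => em; move: ij; rewrite -em ltnNge jm.
rewrite [cl j]/cl; case: ifP => lt_j; last exact: antij.
have antj (m : 'I_n) : (j <= m)%N -> cgen C m * cl i = - (cl i * cgen C m).
  by move=> jm; rewrite antij // opprK.
by rewrite anti_refl ?opprK ?antj // (ordSE lt_j).
Qed.

Let cl_far_sym (i j : 'I_n) : (i.+1 < j)%N || (j.+1 < i)%N ->
  cl i * cl j = - (cl j * cl i).
Proof. by case/orP=> /cl_far // ->; rewrite opprK. Qed.

Let tr_far (i j : 'I_n) : (i.+1 < j)%N || (j.+1 < i)%N ->
  (tr i * tr j = tr j * tr i)%g.
Proof.
wlog ij : i j / (i.+1 < j)%N => [hw|_].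
  by case/orP=> ij; [|apply/esym]; apply: (hw _ _ ij); rewrite ij.
have lt_i : (i.+1 < n)%N by exact: ltn_trans ij (ltn_ord j).
rewrite /tr lt_i; case: ifP => lt_j; last by rewrite mulg1 mul1g.
apply/permP=> x; rewrite !permM.
have neq (a b : 'I_n) : (a < b)%N -> (a != b) && (b != a).
  by move=> ab; rewrite [b == a]eq_sym andbb; apply/eqP=> e; move: ab; rewrite e ltnn.
have /neq/andP[d1 d1'] : (i < j)%N by exact: ltn_trans (ltnSn i) ij.
have /neq/andP[d2 d2'] : (i < ordS j)%N by rewrite ordSE // ltnS (ltnW (ltn_trans (ltnSn i) ij)).
have /neq/andP[d3 d3'] : (ordS i < j)%N by rewrite ordSE.
have /neq/andP[d4 d4'] : (ordS i < ordS j)%N by rewrite !ordSE // ltnS ltnW.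
have [->|ni] := eqVneq x i.
  by rewrite tpermL (tpermD d3' d4') (tpermD d1' d2') tpermL.
have [->|nSi] := eqVneq x (ordS i).
  by rewrite tpermR (tpermD d1' d2') (tpermD d3' d4') tpermR.
rewrite (tpermD (x := i) (y := ordS i) (z := x)) 1?eq_sym //.
have [->|nj] := eqVneq x j; first by rewrite tpermL (tpermD d2 d4).
have [->|nSj] := eqVneq x (ordS j); first by rewrite tpermR (tpermD d1 d3).
by rewrite !tpermD // eq_sym.
Qed.

Fact phiB_respects : respects (@spin_rel C n) phiB_gen.
Proof.
move=> _ _ [i|i j ji lt_j|i j ij|i j ji jn]; rewrite ?teval_exp /= ?rmorph1
  ?rmorphN1 !phiB_genE.
- by rewrite expr2 tsM cl_sq tr_sq -[1 in LHS](rmorph1 (alg_scalar (clif C n))) tsS rmorph1.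
- have lt_i : (i.+1 < n)%N by rewrite -ji ltnW.
  have Si : ordS i = j by apply: val_inj; rewrite [LHS]ordSE // ji.
  have iSj : i != ordS j.
    by apply/eqP=> e; move: (ordSE lt_j); rewrite -e ji => /eqP; rewrite ltn_eqF // ltnS ltnW.
  rewrite !tsM; congr ts.
    rewrite /cl lt_i lt_j Si; apply: refl_braid; rewrite ?cgen_sq //;
      apply: cgen_anti => //; [by rewrite -Si neqS | exact: neqS].
  rewrite /tr lt_i lt_j Si.
  have -> : (tperm i j * tperm j (ordS j) * tperm i j =
             tperm j (ordS j) ^ tperm i j)%g by rewrite conjgE tpermV mulgA.
  have -> : (tperm j (ordS j) * tperm i j * tperm j (ordS j) =
             tperm i j ^ tperm j (ordS j))%g by rewrite conjgE tpermV mulgA.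
  have ij : i != j by rewrite -Si neqS.
  have jSj : j != ordS j by exact: neqS.
  rewrite !tpermJ tpermL tpermR (tpermD iSj jSj).
  by rewrite (tpermD (x := j) (y := ordS j) (z := i)) // eq_sym.
- rewrite tsM tsX (anti_far (cl_sq i) (cl_sq j) (cl_far_sym ij)).
  by rewrite expgS expg1 {2}(tr_far ij) mulgA -(mulgA (tr i)) tr_sq mulg1 tr_sq.
- have lt_i : (i.+1 < n)%N by rewrite -ji.
  have Si : ordS i = j by apply: val_inj; rewrite [LHS]ordSE // ji.
  rewrite tsM tsX.
  have -> : ((tr i * tr j) ^+ 4 = 1)%g.
    rewrite {2}/tr jn ltnn mulg1 (expgM _ 2 2).
    by rewrite [(tr i ^+ 2)%g]expgS expg1 tr_sq expg1n.
  rewrite /cl lt_i jn ltnn Si refl_last ?cgen_sq // cgen_anti //.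
  by rewrite -Si neqS.
Qed.

Definition phiB : alg_morphism (spinB C n) target := plift phiB_respects.

End PhiB.

(* The pullback along phiB of the tensor product of U and the Specht module. *)
Definition Blam (C : numClosedFieldType) n (U : clif_supermodule C n) lam :
    alg_morphism (spinB C n) (mxalg C (sm_dim U * \rank (specht_mx C n lam))) :=
  alg_comp (tens_repr (sm_repr U) (grpalg_repr (specht_repr C n lam)))
           (phiB C n).

Definition Blam_char (C : numClosedFieldType) n (U : clif_supermodule C n) lam
    (x : spinB C n) : C :=
  \tr (Blam U lam x : 'M_(sm_dim U * \rank (specht_mx C n lam))).

Section CanonicalElements.
Variables (F : comNzRingType) (n : nat).

(* Total in the index; the value 1 out of range is never used below. *)
Definition sgen_nat (i : nat) : spinB F n := oapp (@sgen F n) 1 (insub i).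

(* b_i, where m is the number of steps from i to the last index. *)
Fixpoint bgen_rec (m i : nat) : spinB F n :=
  if m is m'.+1 then sgen_nat i * bgen_rec m' i.+1 * sgen_nat i
  else sgen_nat i.
Definition bgen (i : nat) : spinB F n := bgen_rec (n.-1 - i) i.

(* The cycles of length m >= 1 that permute a, ..., a + m - 1. *)
Definition pos_cycle (a m : nat) : spinB F n :=
  \prod_(a <= i < (a + m).-1) sgen_nat i.
Definition neg_cycle (a m : nat) : spinB F n :=
  pos_cycle a m * bgen (a + m).-1.

Fixpoint cycle_prod (cyc : nat -> nat -> spinB F n) (a : nat) (s : seq nat) :
    spinB F n :=
  if s is m :: s' then cyc a m * cycle_prod cyc (a + m) s' else 1.

(* s and s' list the lengths of the positive and of the negative cycles in the
   order of their intervals. *)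
Definition canonical_elt (s s' : seq nat) : spinB F n :=
  cycle_prod pos_cycle 0 s * cycle_prod neg_cycle (sumn s) s'.

End CanonicalElements.

Definition is_partition (s : seq nat) : bool := sorted geq s && (0%N \notin s).

Definition part_union (s s' : seq nat) : seq nat := sort geq (s ++ s').

Definition cycle_type n (w : 'S_n) : seq nat :=
  sort geq [seq #|pred_of_set c| | c <- enum (porbits w)].

(* Main.v *)
Require Import Defs.
From mathcomp Require Import all_boot all_order all_fingroup all_algebra.
From mathcomp Require Import mxrepresentation.
From mathcomp Require Import reals complex mxtens.
From mathcomp Require Import zify ring.

Set Implicit Arguments.
Unset Strict Implicit.
Unset Printing Implicit Defensive.

Import Order.TTheory GRing.Theory Num.Theory.
Local Open Scope ring_scope.

(** Under the isomorphism phi^B a generator t_i acts on the tensor product of U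
    and the Specht module as k (c_i - c_(i+1)) (x) s_i with k = 1 / sqrt 2, and
    b_i acts as (-1)^(n-i) c_i (x) 1: conjugation by the odd unit vector
    k (c_i - c_(i+1)) sends c_(i+1) to - c_i. A canonical element therefore
    acts as X (x) g, where X is a product of vectors of the Clifford algebra and
    g is a permutation ([acts_as_pos_word], [acts_as_neg_word]), and its
    character is tr X * chi(g).

    The permutation g has cycles of lengths the parts of alpha and beta, so it is
    conjugate to w ([cycle_type_conj]), which gives the factor chi(w).

    The trace of X only sees its scalar part, because e y has trace 0 whenever
    the involution e anticommutes with y ([mxtrace_anticomm]). Reading X from the
    left, two consecutive factors k (c_a - c_(a+1)) k (c_(a+1) - c_(a+2)) may be
    replaced by - k^2: any other choice of terms leaves some c_j that occurs only
    once. A cycle of odd length m is (m-1)/2 such pairs, and a negative cycle of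
    even length m ends with k (c_j - c_(j+1)) c_(j+1), which may be replaced by
    - k. Both kinds of cycles thus contribute (-1)^(m/2) k^(m-1), with m/2
    rounded down ([cycle_weight]). The signs (-1)^(n-i) of the b_i disappear,
    as all the intervals to the right of a negative cycle have even length.

    It remains to find dim U = 2^(ceil (n/2)) ([simple_supermodule_dim]). The
    c_i and the parity operator are N = n + 1 anticommuting involutions without
    a common invariant subspace ([irr_clifford_dim]). Group them into pairs
    (e, e'); the operators i e e' are commuting involutions. The product p of the
    idempotents (1 + i e e') / 2 has trace d / 2^(N/2), by the same vanishing of
    traces, and the trace of an idempotent is its rank; so d is a positive
    multiple of 2^(N/2). On the other hand a vector fixed by p generates an
    invariant subspace of dimension at most 2^(N/2), by applying one element
    of each pair or not, and this subspace is everything. When N is odd, the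
    element left over is, up to sign, the product of the i e e', since their
    product with it is a central involution. Finally
    sqrt 2^(n + (n mod 2)) * k^(n - l) = sqrt 2^(l + (n mod 2)), where
    l is the number of parts of alpha and beta. *)

(** * Anticommutation and traces *)

Definition anticomm (A : pzRingType) (x y : A) := x * y == - (y * x).

Section Anticomm.
Variable A : pzRingType.
Implicit Types x y z : A.

Lemma anticomm_sym x y : anticomm x y = anticomm y x.
Proof. by rewrite /anticomm eq_sym -[RHS]eqr_opp opprK. Qed.

Lemma anticommM x y z : anticomm x y -> anticomm x z -> GRing.comm x (y * z).
Proof.
move=> /eqP xy /eqP xz.
by rewrite /GRing.comm mulrA xy mulNr -mulrA xz mulrN opprK mulrA.
Qed.

Lemma anticomm_commM x y z : anticomm x y -> GRing.comm x z -> anticomm x (y * z).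
Proof.
by move=> /eqP xy xz; rewrite /anticomm mulrA xy mulNr -!mulrA xz.
Qed.

Lemma anticommB x y z : anticomm x y -> anticomm x z -> anticomm x (y - z).
Proof.
move=> /eqP xy /eqP xz.
by rewrite /anticomm mulrBr mulrBl xy xz opprB opprK addrC.
Qed.
End Anticomm.

Section MatrixAnticomm.
Variables (F : fieldType) (d : nat).
Implicit Types x y e : 'M[F]_d.

Lemma scale_mulmxl a x y : (a *: x : 'M[F]_d) * y = a *: (x * y).
Proof. by rewrite [RHS]scalemxAl. Qed.

Lemma scale_mulmxr a x y : x * (a *: y : 'M[F]_d) = a *: (x * y).
Proof. by rewrite [RHS]scalemxAr. Qed.

Lemma commrZ a x y : GRing.comm x y -> GRing.comm x (a *: y).
Proof.
by move=> xy; rewrite /GRing.comm scale_mulmxr scale_mulmxl xy.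
Qed.

Lemma anticommZ a x y : anticomm x y -> anticomm x (a *: y).
Proof.
by move=> /eqP xy; rewrite /anticomm scale_mulmxr scale_mulmxl xy scalerN.
Qed.

End MatrixAnticomm.

(** Cyclicity of the trace: tr (e x) = tr (x e) = - tr (e x). *)
Lemma mxtrace_anticomm (F : numFieldType) d (e x : 'M[F]_d) :
  e * e = 1 -> anticomm e x -> \tr (e * x) = 0.
Proof.
move=> ee /eqP ex; have : \tr (e * x) = - \tr (e * x).
  by rewrite {1}ex raddfN; congr (- _); exact: mxtrace_mulC.
by move/eqP; rewrite -addr_eq0 -mulr2n mulrn_eq0 => /eqP.
Qed.

(** In a full-rank factorization p = A B, the equation p p = p cancels to
    B A = 1, and tr (A B) = tr (B A). *)
Lemma mxtrace_idempotent (F : fieldType) d (p : 'M[F]_d) :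
  p * p = p -> \tr p = (\rank p)%:R.
Proof.
move=> pp; rewrite -{1}(mulmx_base p) mxtrace_mulC.
have -> : row_base p *m col_base p = 1%:M; last by rewrite mxtrace1.
have: col_base p *m (row_base p *m col_base p) *m row_base p =
      col_base p *m 1%:M *m row_base p.
  by rewrite mulmx1 mulmxA -(mulmxA _ (col_base p)) !mulmx_base.
by move/(row_free_inj (row_base_free p))/(row_full_inj (col_base_full p)).
Qed.

Lemma mxtrace_tens (F : comPzRingType) m p (A : 'M[F]_m) (B : 'M[F]_p) :
  \tr (A *t B) = \tr A * \tr B.
Proof.
by rewrite /mxtrace mulr_sum; apply: eq_bigr => i _; rewrite !mxE.
Qed.

(** * Dimension of the irreducible modules of Clifford algebras *)

Section CliffordDimension.
Variables (C : numClosedFieldType) (d : nat).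
Local Notation M := 'M[C]_d.
Implicit Types (e g x : M) (es : seq M).

Definition clifford_seq es := all (fun e => e * e == 1) es && pairwise (@anticomm M) es.

(** The factor i makes the product of two anticommuting involutions an
    involution. The [cartan] elements of disjoint pairs commute. *)
Definition cartan e e' : M := 'i *: (e * e').

Lemma anticomm2_cartan g e e' : anticomm g e -> anticomm g e' -> GRing.comm g (cartan e e').
Proof. by move=> ge ge'; apply/commrZ/anticommM. Qed.

Lemma cartan_sq e e' : e * e = 1 -> e' * e' = 1 -> anticomm e e' ->
  cartan e e' * cartan e e' = 1.
Proof.
move=> ee ee' /eqP a; rewrite /cartan.
rewrite scale_mulmxl scale_mulmxr scalerA -expr2 sqrCi scaleN1r.
by rewrite {1}a mulNr opprK -mulrA (mulrA e) ee mul1r ee'.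
Qed.

Lemma anticomm_cartan e e' : anticomm e e' ->
  anticomm e (cartan e e') /\ anticomm e' (cartan e e').
Proof.
move=> a; split; apply: anticommZ; last first.
  by apply: anticomm_commM; rewrite 1?anticomm_sym //; exact: commr_refl.
by rewrite /anticomm -mulrA -mulrN (eqP a).
Qed.

Lemma mul_cartan e e' : e * e = 1 -> e * cartan e e' = 'i *: e'.
Proof.
by move=> ee; rewrite scale_mulmxr mulrA ee mul1r.
Qed.

(** The next three definitions consume a sequence two elements at a time, each
    pair (e, e') giving one commuting involution [cartan e e']. An unpaired last
    element is ignored. *)
Fixpoint cartan_proj es : M :=
  if es is e :: e' :: es' then (2^-1 *: (1 + cartan e e')) * cartan_proj es' else 1.

Fixpoint cartan_prod es : M :=
  if es is e :: e' :: es' then cartan e e' * cartan_prod es' else 1.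

(** The row space spanned by the vectors u ... f^b e^a, with exponents in {0, 1},
    for the first elements e, f, ... of the pairs. *)
Fixpoint cartan_span (u : M) es : M :=
  if es is e :: e' :: es' then
    (cartan_span u es' + cartan_span u es' *m e)%MS else u.

Lemma pairs_ind (P : seq M -> Prop) :
  P [::] -> (forall e, P [:: e]) ->
  (forall e e' es, P es -> P (e :: e' :: es)) -> forall es, P es.
Proof.
move=> P0 P1 PS es; suff [] : P es /\ forall e, P (e :: es) by [].
by elim: es => [|e es [IH IHc]]; split=> // e'; exact: PS.
Qed.

Lemma clifford_cons2 e e' es : clifford_seq (e :: e' :: es) ->
  [/\ e * e = 1, e' * e' = 1 & anticomm e e'] /\
  [/\ {in es, forall g, anticomm e g}, {in es, forall g, anticomm e' g}
    & clifford_seq es].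
Proof.
rewrite /clifford_seq /=.
case/andP=> /and3P[/eqP -> /eqP -> ->] /and3P[/andP[-> /allP h] /allP h' ->].
by do !split.
Qed.

Lemma comm_cartan_proj g es :
  {in es, forall e, anticomm g e} -> GRing.comm g (cartan_proj es).
Proof.
elim/pairs_ind: es => [|e|e e' es IH] h; try exact: commr1.
have [he he'] : anticomm g e /\ anticomm g e' by split; apply: h; rewrite !inE eqxx ?orbT.
apply: commrM; last by apply: IH => x xes; apply: h; rewrite !inE xes !orbT.
by apply/commrZ/commrD; [exact: commr1 | exact: anticomm2_cartan].
Qed.

Lemma comm_cartan_prod g es :
  {in es, forall e, anticomm g e} -> GRing.comm g (cartan_prod es).
Proof.
elim/pairs_ind: es => [|e|e e' es IH] h; try exact: commr1.
have [he he'] : anticomm g e /\ anticomm g e' by split; apply: h; rewrite !inE eqxx ?orbT.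
apply: commrM; last by apply: IH => x xes; apply: h; rewrite !inE xes !orbT.
exact: anticomm2_cartan.
Qed.

Lemma comm_cartan g e e' : GRing.comm g e -> GRing.comm g e' -> GRing.comm g (cartan e e').
Proof. by move=> ge ge'; apply/commrZ/commrM. Qed.

Lemma comm_cartan_cartan_proj e e' es :
  {in es, forall g, anticomm e g} -> {in es, forall g, anticomm e' g} ->
  GRing.comm (cartan e e') (cartan_proj es).
Proof.
by move=> he he'; apply/commr_sym/comm_cartan; apply/commr_sym/comm_cartan_proj.
Qed.

(** If h h = 1, then (1 + h) / 2 is the projection on the eigenspace of h with
    eigenvalue 1. *)
Lemma half_cartan e e' : e * e = 1 -> e' * e' = 1 -> anticomm e e' ->
  let f := 2^-1 *: (1 + cartan e e') in f * f = f /\ f * cartan e e' = f.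
Proof.
move=> ee ee' a f; have hh := cartan_sq ee ee' a.
have fh : f * cartan e e' = f.
  by rewrite /f scale_mulmxl mulrDl mul1r hh addrC.
split=> //; rewrite {2}/f scale_mulmxr mulrDr mulr1 fh.
by rewrite -mulr2n -scaler_nat scalerA mulVf ?scale1r // pnatr_eq0.
Qed.

Lemma cartan_proj_idem es : clifford_seq es ->
  cartan_proj es * cartan_proj es = cartan_proj es.
Proof.
elim/pairs_ind: es => [|e|e e' es IH] /=; rewrite ?mulr1 //.
case/clifford_cons2=> -[ee ee' a] [he he' /IH pp].
have [ff _] := half_cartan ee ee' a; move: ff.
have: GRing.comm (2^-1 *: (1 + cartan e e')) (cartan_proj es).
  by apply/commr_sym/commrZ/commrD; [exact: commr1 | exact/commr_sym/comm_cartan_cartan_proj].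
move: (_ *: _) => f fp ff.
by rewrite mulrA -(mulrA f) -fp mulrA ff -mulrA pp.
Qed.

(** Each pair halves the trace: e anticommutes with e' y when y is the projection
    of the later pairs, so the term i e e' y of the product has trace 0. *)
Lemma mxtrace_cartan_proj es : clifford_seq es ->
  \tr (cartan_proj es) = d%:R / 2 ^+ (size es)./2.
Proof.
elim/pairs_ind: es => [|e|e e' es IH] /=; try by rewrite expr0 divr1 mxtrace1.
case/clifford_cons2=> -[ee ee' a] [he he' /IH {}IH].
rewrite scale_mulmxl mxtraceZ mulrDl mul1r mxtraceD IH.
rewrite scale_mulmxl mxtraceZ -mulrA.
rewrite mxtrace_anticomm ?mulr0 ?addr0 //; last first.
  by apply: anticomm_commM a _; exact: comm_cartan_proj.
by rewrite mulrCA exprS invfM.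
Qed.

Lemma cartan_prod_sq es : clifford_seq es -> cartan_prod es * cartan_prod es = 1.
Proof.
elim/pairs_ind: es => [|e|e e' es IH] /=; rewrite ?mulr1 //.
case/clifford_cons2=> -[ee ee' a] [he he' /IH pp].
have /esym := cartan_sq ee ee' a; move=> ->.
have: GRing.comm (cartan e e') (cartan_prod es).
  by apply/commr_sym/comm_cartan; apply/commr_sym/comm_cartan_prod.
move: (cartan e e') => f fp.
by rewrite mulrA -(mulrA f) -fp mulrA -mulrA pp mulr1.
Qed.

(** A generator g commutes with the [cartan] elements of all the pairs except its
    own, with which it anticommutes. *)
Lemma anticomm_cartan_prod es : ~~ odd (size es) -> clifford_seq es ->
  {in es, forall g, anticomm g (cartan_prod es)}.
Proof.
elim/pairs_ind: es => [|e|e e' es IH] //=; rewrite negbK => ev.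
case/clifford_cons2=> -[ee ee' a] [he he' /(IH ev) {}IH] g.
rewrite !inE => /or3P[/eqP->|/eqP->|ges].
- by apply: anticomm_commM (comm_cartan_prod he); case: (anticomm_cartan a).
- by apply: anticomm_commM (comm_cartan_prod he'); case: (anticomm_cartan a).
have gh : GRing.comm g (cartan e e').
  by apply: anticomm2_cartan; rewrite anticomm_sym; [exact: he | exact: he'].
by move: (IH g ges) => /eqP gq; rewrite /anticomm mulrA gh -mulrA gq mulrN mulrA.
Qed.

Lemma cartan_span_stable_comm u h es :
  {in es, forall g, GRing.comm h g} -> stablemx u h -> stablemx (cartan_span u es) h.
Proof.
elim/pairs_ind: es => [|e|e e' es IH] //= hc uh.
have Wh : stablemx (cartan_span u es) h.
  by apply: IH => // g ges; apply: hc; rewrite !inE ges !orbT.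
apply: stableDmx => //; rewrite -mulmxA.
have -> : e *m h = h *m e by apply/esym/hc; rewrite inE eqxx.
by rewrite mulmxA submxMr.
Qed.

Lemma cartan_span_sub u es : (u <= cartan_span u es)%MS.
Proof.
by elim/pairs_ind: es => [|e|e e' es IH] //=; apply: submx_trans IH (addsmxSl _ _).
Qed.

Lemma rank_cartan_span u es : (\rank u <= 1)%N ->
  (\rank (cartan_span u es) <= 2 ^ (size es)./2)%N.
Proof.
move=> u1; elim/pairs_ind: es => [|e|e e' es IH] //=.
rewrite expnS mul2n -addnn (leq_trans (mxrank_adds_leqif _ _)) // leq_add //.
by rewrite (leq_trans (mxrankM_maxl _ _)).
Qed.

(** Let W be the span for the pairs after (e, e'). The space W + W e is stable
    under e because e e = 1, and under [cartan e e'] because the latter commutes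
    with the later pairs, fixes u, and anticommutes with e. Since e' is a scalar
    multiple of e * cartan e e', stability under e' follows. *)
Lemma cartan_span_stable u es : ~~ odd (size es) -> clifford_seq es ->
  (u <= cartan_proj es)%MS -> {in es, forall g, stablemx (cartan_span u es) g}.
Proof.
elim/pairs_ind: es => [|e|e e' es IH] //=; rewrite negbK => ev.
case/clifford_cons2=> -[ee ee' a] [he he' cs] up.
have hp := comm_cartan_cartan_proj he he'; have [_ fh] := half_cartan ee ee' a.
have up' : (u <= cartan_proj es)%MS by apply: submx_trans up (submxMl _ _).
have uh : u *m cartan e e' = u.
  case/submxP: up => v ->; rewrite -mulmxA; congr (_ *m _).
  by rewrite -[LHS]mulrA -hp mulrA fh.
move: (IH ev cs up') => {}IH.
have Wh : stablemx (cartan_span u es) (cartan e e').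
  apply: cartan_span_stable_comm; last by rewrite uh.
  move=> g ges; apply/commr_sym/anticomm2_cartan; rewrite anticomm_sym; [exact: he | exact: he'].
have We : stablemx (cartan_span u es + cartan_span u es *m e)%MS e.
  rewrite addsmxMr addsmx_sub addsmxSr /= -mulmxA.
  by rewrite -[e *m e]/(e * e) ee mulmx1 addsmxSl.
have Whe : stablemx (cartan_span u es + cartan_span u es *m e)%MS (cartan e e').
  apply: stableDmx => //; rewrite -mulmxA.
  have -> : e *m cartan e e' = - (cartan e e' *m e).
    by apply/eqP; have [] := anticomm_cartan a.
  by rewrite mulmxN eqmx_opp mulmxA submxMr.
have We' : stablemx (cartan_span u es + cartan_span u es *m e)%MS e'.
  have -> : e' = - 'i *: (e *m cartan e e').
    rewrite [e *m _]mul_cartan // scalerA mulNr -expr2 sqrCi opprK.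
    by rewrite scale1r.
  by rewrite -scalemxAr scalemx_sub // stablemxM.
move=> g; rewrite !inE => /or3P[/eqP->|/eqP->|ges] //.
apply: stableDmx; first exact: IH.
rewrite -mulmxA; have -> : e *m g = - (g *m e) by apply/eqP/he.
by rewrite mulmxN eqmx_opp mulmxA submxMr // IH.
Qed.

Lemma cartan_proj_neq0 es : (0 < d)%N -> clifford_seq es -> cartan_proj es != 0.
Proof.
move=> d0 cs; apply/eqP=> p0.
have := mxtrace_cartan_proj cs; rewrite p0 mxtrace0 => /esym/eqP.
by rewrite mulf_eq0 invr_eq0 expf_eq0 !pnatr_eq0 andbF orbF -leqn0 leqNgt d0.
Qed.

(** The cofactor of the power of 2 is the rank of [cartan_proj es]. *)
Lemma dim_clifford_dvd es : (0 < d)%N -> clifford_seq es ->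
  exists2 r, (0 < r)%N & d = (r * 2 ^ (size es)./2)%N.
Proof.
move=> d0 cs; exists (\rank (cartan_proj es)); last first.
  apply/eqP; rewrite -(eqr_nat C) natrM natrX.
  rewrite -mxtrace_idempotent ?cartan_proj_idem // mxtrace_cartan_proj //.
  by rewrite divfK // expf_neq0 // pnatr_eq0.
by rewrite lt0n mxrank_eq0 cartan_proj_neq0.
Qed.

(** By [dim_clifford_dvd] it suffices to bound the dimension from above; the span
    generated by one nonzero vector in the image of the projection does it. *)
Lemma irr_clifford_dim_even es : (0 < d)%N -> clifford_seq es -> ~~ odd (size es) ->
  (forall V : M, {in es, forall e, stablemx V e} -> V = 0 \/ row_full V) ->
  d = (2 ^ (size es)./2)%N.
Proof.
move=> d0 cs ev irr; have [r r0 dE] := dim_clifford_dvd d0 cs.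
suff : (d <= 2 ^ (size es)./2)%N.
  move=> d_le; suff r1 : r = 1%N by rewrite [LHS]dE r1 mul1n.
  apply/eqP; rewrite eqn_leq r0 andbT -(leq_pmul2r (expn_gt0 2 (size es)./2)).
  by rewrite mul1n -[leqLHS]dE.
have p0 := cartan_proj_neq0 d0 cs.
pose u : M := (<<nz_row (cartan_proj es)>>)%MS.
have up : (u <= cartan_proj es)%MS by rewrite genmxE nz_row_sub.
have u1 : (\rank u <= 1)%N by rewrite genmxE rank_leq_row.
have [W0|/eqP dW] := irr _ (cartan_span_stable ev cs up); last first.
  by rewrite -[leqLHS]dW rank_cartan_span.
have := cartan_span_sub u es; rewrite W0 submx0 -mxrank_eq0 genmxE mxrank_eq0.
by rewrite nz_row_eq0 (negPf p0).
Qed.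

(** For an odd number of generators e0 :: es, the element z = e0 * cartan_prod es
    commutes with all of them and z z = 1. The row space of z + 1 is invariant,
    hence z = 1 or z = -1, and e0 is a multiple of [cartan_prod es]: every space
    stable under es is stable under e0, and the even case applies to es. *)
Lemma irr_clifford_dim es : (0 < d)%N -> clifford_seq es ->
  (forall V : M, {in es, forall e, stablemx V e} -> V = 0 \/ row_full V) ->
  d = (2 ^ (size es)./2)%N.
Proof.
move=> d0 cs irr; have [od|ev] := boolP (odd (size es)); last first.
  exact: irr_clifford_dim_even.
case: es od cs irr => [|e0 es] //= ev cs irr.
have {cs} [ee0 he0 cs] : [/\ e0 * e0 = 1, {in es, forall g, anticomm e0 g} & clifford_seq es].
  move: cs; rewrite /clifford_seq /= => /andP[/andP[/eqP-> ->] /andP[/allP h ->]].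
  by split=> // g; exact: h.
rewrite uphalf_half (negPf ev) add0n.
have cz : {in es, forall g, GRing.comm g (e0 * cartan_prod es)}.
  move=> g ges; apply: anticommM; first by rewrite anticomm_sym he0.
  exact: anticomm_cartan_prod.
have qq := cartan_prod_sq cs; have e0q := comm_cartan_prod he0.
have zz : (e0 * cartan_prod es) * (e0 * cartan_prod es) = 1.
  by rewrite {1}e0q mulrA -(mulrA _ e0 e0) ee0 mulr1.
have e0E : exists a, e0 = a *: cartan_prod es.
  have [|z1|zf] := irr (e0 * cartan_prod es + 1).
  - move=> g; rewrite inE => /orP[/eqP->|ges]; apply: comm_mx_stable; apply/commr_sym.
      by apply: commrD (commr1 _); apply: commrM.
    by apply: commrD (commr1 _); apply: cz.
  - exists (-1); rewrite scaleN1r; apply/eqP; rewrite -addr_eq0; apply/eqP.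
    by rewrite -[LHS]mulr1 -[X in _ * X = _]qq mulrA mulrDl qq z1 mul0r.
  - exists 1; rewrite scale1r; apply/eqP; rewrite -subr_eq0; apply/eqP.
    have : (e0 * cartan_prod es + 1) *m (e0 * cartan_prod es - 1) = (e0 * cartan_prod es + 1) *m 0.
      rewrite mulmx0 -[LHS]/(_ * _) mulrDl mul1r mulrBr mulr1 zz.
      by rewrite addrA subrK subrr.
    move/(row_full_inj zf) => z1.
    by rewrite -[LHS]mulr1 -[X in _ * X = _]qq mulrA mulrBl qq z1 mul0r.
apply: irr_clifford_dim_even => // V Vst; apply: irr => g.
rewrite inE => /orP[/eqP->|]; last exact: Vst.
have [a ->] := e0E; rewrite -scalemxAr scalemx_sub //.
elim/pairs_ind: es ev Vst {cz he0 cs qq e0q zz e0E} => [|e|e e' es IH] //= ev Vst.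
- exact: (stablemxC V 1).
apply: stablemxM; last first.
  apply: IH => [|x xes]; first by rewrite negbK in ev.
  by apply: Vst; rewrite !inE xes !orbT.
by rewrite -scalemxAr scalemx_sub // stablemxM // Vst // !inE eqxx ?orbT.
Qed.

End CliffordDimension.

Section SupermoduleDim.
Variables (C : numClosedFieldType) (n : nat) (U : clif_supermodule C n).
Local Notation M := 'M[C]_(sm_dim U).

Definition clif_mx (i : 'I_n) : M := sm_repr U (cgen C i).

Lemma clif_mx_sq i : clif_mx i * clif_mx i = 1.
Proof. by rewrite /clif_mx -[LHS]rmorphM cgen_sq rmorph1. Qed.

Lemma clif_mx_anti i j : i != j -> anticomm (clif_mx i) (clif_mx j).
Proof.
by move=> ij; rewrite /anticomm /clif_mx -[eqbLHS]rmorphM cgen_anti // rmorphN rmorphM.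
Qed.

(** The elements that stabilize V form a subalgebra. *)
Lemma stable_clif (V : M) : (forall i, stablemx V (clif_mx i)^T) ->
  forall x : clif C n, stablemx V (sm_repr U x : M)^T.
Proof.
move=> Vst; elim/pind=> t; rewrite -[pcls _ t]/(pcls (@clif_rel C n) t) pcls_teval.
elim: t => [i|a|x IHx y IHy|x IHx y IHy] /=.
- exact: Vst.
- by rewrite alg_fun_scalar /= tr_scalar_mx stablemxC.
- by rewrite rmorphD linearD /= stablemxD.
- by rewrite rmorphM -[_ * _]/(_ *m _) trmx_mul stablemxM.
Qed.

Lemma anticomm_tr (x y : M) : anticomm x y -> anticomm x^T y^T.
Proof.
move=> /eqP xy; rewrite anticomm_sym /anticomm -[eqbLHS]trmx_mul -[_ *m _]/(x * y) xy.
by rewrite linearN /= -[y * x]/(y *m x) trmx_mul.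
Qed.

Lemma sq_tr (x : M) : x * x = 1 -> x^T * x^T = 1.
Proof. by move=> xx; rewrite -[LHS]trmx_mul -[_ *m _]/(x * x) xx -[1]/(1%:M) trmx1. Qed.

(** Adding the parity operator to the n generators turns graded submodules into
    invariant subspaces of n + 1 anticommuting involutions. The matrices are
    transposed to act on rows. *)
Lemma simple_supermodule_dim : simple_supermodule U -> sm_dim U = (2 ^ uphalf n)%N.
Proof.
case=> d0 irr.
pose es : seq M := (sm_parity U)^T :: [seq (clif_mx i)^T | i <- enum 'I_n].
have sz : size es = n.+1 by rewrite /= size_map size_enum_ord.
have -> : (uphalf n = (size es)./2)%N by rewrite sz.
apply: irr_clifford_dim => //.
- apply/andP; split.
    rewrite /= (sq_tr (sm_parity_sq U)) eqxx all_map /=.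
    by apply/allP=> i _ /=; rewrite sq_tr // clif_mx_sq.
  rewrite pairwise_cons all_map pairwise_map; apply/andP; split.
    by apply/allP=> i _; apply/anticomm_tr/eqP/sm_parity_odd.
  have := enum_uniq 'I_n; rewrite uniq_pairwise; apply: sub_pairwise => i j /= ij.
  exact/anticomm_tr/clif_mx_anti.
move=> V Vst; apply: irr; last by apply: Vst; rewrite inE eqxx.
by apply: stable_clif => i; apply: Vst; apply/predU1P; right;
  apply: (map_f (fun i => (clif_mx i)^T)); rewrite mem_enum.
Qed.
End SupermoduleDim.

(** * Traces of Clifford words *)

Section WordTrace.
Variables (F : numFieldType) (d n : nat) (c : nat -> 'M[F]_d) (k : F).
Hypothesis c_sq : forall i, (i < n)%N -> c i * c i = 1.
Hypothesis c_anti : forall i j, (i < n)%N -> (j < n)%N -> i != j -> anticomm (c i) (c j).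

Definition root_vec (i : nat) : 'M[F]_d := k *: (c i - c i.+1).

Definition pos_word (a m : nat) : 'M[F]_d := \prod_(a <= i < (a + m).-1) root_vec i.
(** The image of b_i is c_i up to a sign, which is 1 at the end of every negative
    cycle of a canonical element. *)
Definition neg_word (a m : nat) : 'M[F]_d := pos_word a m * c (a + m).-1.

Fixpoint cat_word (cyc : nat -> nat -> 'M[F]_d) (a : nat) (s : seq nat) : 'M[F]_d :=
  if s is m :: s' then cyc a m * cat_word cyc (a + m) s' else 1.

(** The scalar part of the word of a cycle of length m, positive if m is odd and
    negative if m is even. *)
Definition cycle_weight (m : nat) : F := (-1) ^+ m./2 * k ^+ m.-1.

Lemma anticomm_root_vec i j : (i < j)%N -> (j.+1 < n)%N -> anticomm (c i) (root_vec j).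
Proof. by move=> ij jn; apply/anticommZ/anticommB; apply: c_anti; lia. Qed.

(** Expanding both vectors, c_a occurs once, so its term has trace 0; the term
    - c_(a+1) of the first vector must then meet the c_(a+1) of the second one,
    as c_(a+1) c_(a+2) r also has trace 0. *)
Lemma mxtrace_root_vec2 a r : (a.+2 < n)%N -> GRing.comm (c a) r -> GRing.comm (c a.+1) r ->
  \tr (root_vec a * (root_vec a.+1 * r)) = - (k ^+ 2) * \tr r.
Proof.
move=> an ca ca1.
have t1 : \tr (c a * (root_vec a.+1 * r)) = 0.
  apply: mxtrace_anticomm; first by apply: c_sq; lia.
  by apply: anticomm_commM ca; apply: anticomm_root_vec.
have t2 : \tr (c a.+1 * (c a.+2 * r)) = 0.
  apply: mxtrace_anticomm; first by apply: c_sq; lia.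
  by apply: anticomm_commM ca1; apply: c_anti; lia.
rewrite -[root_vec a * _]scalemxAl mxtraceZ -[_ *m _]/(_ * _) mulrBl linearB /= t1 sub0r.
rewrite -[root_vec a.+1 * _]scalemxAl -[c a.+1 * _]scalemxAr mxtraceZ.
rewrite -[_ *m (_ *m _)]/(_ * (_ * _)) mulrBl mulrBr linearB /= t2 subr0.
by rewrite mulrA c_sq ?mul1r; [rewrite mulrN mulrA mulNr | lia].
Qed.

Lemma mxtrace_root_vec_last a r : (a.+1 < n)%N -> GRing.comm (c a) r ->
  \tr (root_vec a * (c a.+1 * r)) = - k * \tr r.
Proof.
move=> an ca.
have t1 : \tr (c a * (c a.+1 * r)) = 0.
  apply: mxtrace_anticomm; first by apply: c_sq; lia.
  by apply: anticomm_commM ca; apply: c_anti; lia.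
rewrite -[root_vec a * _]scalemxAl mxtraceZ -[_ *m _]/(_ * _) mulrBl linearB /= t1 sub0r.
by rewrite mulrA c_sq ?mul1r; [rewrite mulrN mulNr | lia].
Qed.

(** Traces are computed two vectors at a time, so a cycle is cut into an even
    number of vectors followed, for a negative cycle, by the last two factors. *)
Definition chain a q : 'M[F]_d := \prod_(a <= i < a + q.*2) root_vec i.

Lemma chain0 a : chain a 0 = 1.
Proof. by rewrite /chain big_geq ?addn0. Qed.

Lemma chainS a q : chain a q.+1 = root_vec a * (root_vec a.+1 * chain a.+2 q).
Proof.
have lt1 : (a < a + q.+1.*2)%N by lia.
have lt2 : (a.+1 < a + q.+1.*2)%N by lia.
rewrite /chain (big_ltn lt1) (big_ltn lt2).
by have -> : (a + q.+1.*2 = a.+2 + q.*2)%N by lia.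
Qed.

Lemma comm_chain i a q : (i < a)%N -> (a + q.*2 < n)%N -> GRing.comm (c i) (chain a q).
Proof.
elim: q a => [|q IH] a ia an; first by rewrite chain0; exact: commr1.
rewrite chainS mulrA; apply: commrM; last by apply: IH; lia.
by apply: anticommM; apply: anticomm_root_vec; lia.
Qed.

Lemma mxtrace_chain a q r : (a + q.*2 < n)%N ->
  (forall i, (i < a + q.*2)%N -> GRing.comm (c i) r) ->
  \tr (chain a q * r) = (- k ^+ 2) ^+ q * \tr r.
Proof.
elim: q a => [|q IH] a an cr; first by rewrite chain0 expr0 !mul1r.
rewrite chainS -!mulrA mxtrace_root_vec2; last 3 first.
- lia.
- by apply: commrM; [apply: comm_chain; lia | apply: cr; lia].
- by apply: commrM; [apply: comm_chain; lia | apply: cr; lia].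
rewrite IH ?exprS ?mulrA //; first lia.
by move=> i ia; apply: cr; lia.
Qed.

Lemma pos_wordE a q : pos_word a q.*2.+1 = chain a q.
Proof. by rewrite /pos_word addnS. Qed.

Lemma neg_wordE a q :
  neg_word a q.*2.+2 = chain a q * (root_vec (a + q.*2) * c (a + q.*2).+1).
Proof.
by rewrite /neg_word /pos_word !addnS /= big_nat_recr ?leq_addr //= -mulrA.
Qed.

(** Concatenation multiplies the weights, for any family of words that satisfies
    the trace formula with respect to every r that commutes with the generators
    of their intervals. Keeping r arbitrary lets the induction read a word from
    left to right. *)
Section CatWord.
Variables (cyc : nat -> nat -> 'M[F]_d) (P : pred nat).
Hypothesis cyc_comm : forall a m i, P m -> (a + m <= n)%N -> (i < a)%N ->
  GRing.comm (c i) (cyc a m).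
Hypothesis cyc_trace : forall a m r, P m -> (a + m <= n)%N ->
  (forall i, (i < a + m)%N -> GRing.comm (c i) r) ->
  \tr (cyc a m * r) = cycle_weight m * \tr r.

Lemma comm_cat_word a s i : all P s -> (a + sumn s <= n)%N -> (i < a)%N ->
  GRing.comm (c i) (cat_word cyc a s).
Proof.
elim: s a => [|m s IH] a /=; first by move=> *; exact: commr1.
case/andP=> Pm Ps an ia; apply: commrM; first by apply: cyc_comm => //; lia.
by apply: IH => //; lia.
Qed.

Lemma mxtrace_cat_word a s r : all P s -> (a + sumn s <= n)%N ->
  (forall i, (i < a + sumn s)%N -> GRing.comm (c i) r) ->
  \tr (cat_word cyc a s * r) = (\prod_(m <- s) cycle_weight m) * \tr r.
Proof.
elim: s a => [|m s IH] a /=; first by rewrite big_nil !mul1r.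
case/andP=> Pm Ps an cr; rewrite big_cons -mulrA -[RHS]mulrA cyc_trace //; first 1 last.
- lia.
- move=> i ia; apply: commrM; last by apply: cr; lia.
  by apply: comm_cat_word => //; lia.
congr (_ * _); apply: IH => //; first lia.
by move=> i ia; apply: cr; lia.
Qed.
End CatWord.

Lemma comm_pos_word a m i : odd m -> (a + m <= n)%N -> (i < a)%N ->
  GRing.comm (c i) (pos_word a m).
Proof.
move=> om; have -> : m = m./2.*2.+1 by lia.
by rewrite pos_wordE => an ia; apply: comm_chain; lia.
Qed.

Lemma comm_neg_word a m i : (0 < m)%N && ~~ odd m -> (a + m <= n)%N -> (i < a)%N ->
  GRing.comm (c i) (neg_word a m).
Proof.
move=> om; have -> : m = m./2.-1.*2.+2 by lia.
rewrite neg_wordE => an ia; apply: commrM; first by apply: comm_chain; lia.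
by apply: anticommM; [apply: anticomm_root_vec; lia | apply: c_anti; lia].
Qed.

Lemma chain_weight q : (- k ^+ 2) ^+ q = (-1) ^+ q * k ^+ q.*2.
Proof. by rewrite -[- k ^+ 2]mulN1r exprMn -exprM mul2n. Qed.

Lemma mxtrace_pos_word a m r : odd m -> (a + m <= n)%N ->
  (forall i, (i < a + m)%N -> GRing.comm (c i) r) ->
  \tr (pos_word a m * r) = cycle_weight m * \tr r.
Proof.
move=> om; have -> : m = m./2.*2.+1 by lia.
move: m./2 => q an cr; rewrite pos_wordE mxtrace_chain; last 2 first.
- lia.
- by move=> i ia; apply: cr; lia.
by rewrite chain_weight /cycle_weight /= uphalf_double.
Qed.

Lemma mxtrace_neg_word a m r : (0 < m)%N && ~~ odd m -> (a + m <= n)%N ->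
  (forall i, (i < a + m)%N -> GRing.comm (c i) r) ->
  \tr (neg_word a m * r) = cycle_weight m * \tr r.
Proof.
move=> om; have -> : m = m./2.-1.*2.+2 by lia.
move: m./2.-1 => q an cr; rewrite neg_wordE -!mulrA mxtrace_chain; last 2 first.
- lia.
- move=> i ia; rewrite mulrA; apply: commrM; last by apply: cr; lia.
  by apply: anticommM; [apply: anticomm_root_vec; lia | apply: c_anti; lia].
rewrite mxtrace_root_vec_last; last 2 first.
- lia.
- by apply: cr; lia.
rewrite chain_weight /cycle_weight /= doubleK !exprS.
by move: (\tr r) (_ ^+ q) (k ^+ _) => t u v; ring.
Qed.

Lemma mxtrace_canonical_word s s' : all odd s -> all (fun m => (0 < m)%N && ~~ odd m) s' ->
  (sumn s + sumn s' <= n)%N ->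
  \tr (cat_word pos_word 0 s * cat_word neg_word (sumn s) s') =
    (\prod_(m <- s ++ s') cycle_weight m) * d%:R.
Proof.
move=> s_odd s_even sn; rewrite (mxtrace_cat_word comm_pos_word mxtrace_pos_word) //.
- rewrite -[cat_word neg_word _ _]mulr1.
  rewrite (mxtrace_cat_word comm_neg_word mxtrace_neg_word) //; last first.
    by move=> i _; exact: commr1.
  by rewrite mxtrace1 big_cat mulrA.
- lia.
- by move=> i ia; apply: (comm_cat_word comm_neg_word).
Qed.

End WordTrace.

Lemma prod_cycle_weight (F : numFieldType) (k : F) s : all (ltn 0) s ->
  \prod_(m <- s) cycle_weight k m =
    (-1) ^+ (sumn s - count odd s)./2 * k ^+ (sumn s - size s).
Proof.
move=> s0; rewrite big_split /= !prodrXr.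
(* m = (m mod 2) + 2 (m / 2), and m = 1 + m.-1 as m > 0. *)
have half_sum : (sumn s = count odd s + (\sum_(m <- s) m./2).*2)%N.
  by elim: s {s0} => [|m s IH] /=; rewrite ?big_nil // big_cons IH; lia.
have pred_sum : (sumn s = size s + \sum_(m <- s) m.-1)%N.
  elim: s s0 {half_sum} => [|m s IH] /=; first by rewrite big_nil.
  by case/andP=> m0 /IH e; rewrite big_cons; lia.
by rewrite {1}half_sum {1}pred_sum !addKn doubleK.
Qed.

(** * Permutations with a given cycle type *)

Lemma perm_eq_map (T1 : eqType) (T2 : eqType) (f : T1 -> T2) s t :
  perm_eq (map f s) t -> exists2 s', perm_eq s' s & map f s' = t.
Proof.
case: s => [|x0 s]; first by rewrite perm_sym => /perm_nilP ->; exists [::].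
rewrite perm_sym => /(perm_iotaP (f x0)) [Is pIs ->]; rewrite size_map in pIs.
exists (map (nth x0 (x0 :: s)) Is).
  by apply/(perm_iotaP x0); exists Is.
rewrite -map_comp; apply/eq_in_map => i; rewrite (perm_mem pIs) mem_iota add0n => i_s.
by rewrite [RHS](nth_map x0).
Qed.

Section BlockPerm.
Variable n : nat.
Local Notation I := 'I_n.+1.

Definition adj (i : nat) : {perm I} := tperm (inord i) (inord i.+1).

(** As permutations act on the right, the leftmost transposition is applied
    first: a is carried all the way up to a + m - 1, and the other entries of the
    interval go down by one. *)
Definition block_cycle (a m : nat) : {perm I} :=
  (\prod_(a <= i < (a + m).-1) adj i)%g.

Fixpoint block_perm (a : nat) (s : seq nat) : {perm I} :=
  if s is m :: s' then (block_cycle a m * block_perm (a + m) s')%g else 1%g.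

Lemma adjE (i : nat) (x : I) : (i.+1 < n.+1)%N ->
  adj i x = (if x == i :> nat then i.+1 else if x == i.+1 :> nat then i else x) :> nat.
Proof.
move=> lt_i; have ltW := ltnW lt_i; rewrite permE /=.
rewrite -[x == inord i]val_eqE -[x == inord i.+1]val_eqE /= !inordK //.
by case: eqP => _; rewrite ?inordK //; case: eqP => _; rewrite ?inordK.
Qed.

Lemma block_cycleE a m (x : I) : (0 < m)%N -> (a + m <= n.+1)%N ->
  block_cycle a m x =
    (if (a <= x < a + m)%N then if x == a :> nat then (a + m).-1 else x.-1 else x) :> nat.
Proof.
case: m => // m _; rewrite /block_cycle addnS /=.
elim: m x => [|m IH] x am.
  by rewrite addn0 big_geq // perm1; case: ifP => //; case: eqP => //; lia.
rewrite addnS big_nat_recr ?leq_addr //= permM adjE; last by lia.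
rewrite IH; last by lia.
by do ![case: ifP]; lia.
Qed.

Lemma block_perm_cat a s s' :
  block_perm a (s ++ s') = (block_perm a s * block_perm (a + sumn s) s')%g.
Proof.
elim: s a => [|m s IH] a /=; first by rewrite mul1g addn0.
by rewrite IH mulgA addnA.
Qed.

Lemma block_perm_out a s (x : I) : all (ltn 0) s -> (a + sumn s <= n.+1)%N ->
  (x < a)%N || (a + sumn s <= x)%N -> block_perm a s x = x.
Proof.
elim: s a => [|m s IH] a /=; first by rewrite perm1.
case/andP=> m0 s0 le_n x_out; rewrite permM.
have -> : block_cycle a m x = x.
  by apply: val_inj; rewrite /= block_cycleE //; [case: ifP => //; lia | lia].
by apply: IH => //; lia.
Qed.

Lemma block_perm_in a s (x : I) : all (ltn 0) s -> (a + sumn s <= n.+1)%N ->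
  (a <= x < a + sumn s)%N -> (a <= block_perm a s x < a + sumn s)%N.
Proof.
move=> s0 le_n x_in; apply: contraT => y_out.
(* A point that left the block would be fixed, hence equal to x. *)
have fixy : block_perm a s (block_perm a s x) = block_perm a s x.
  by apply: block_perm_out => //; lia.
by move: y_out; rewrite (perm_inj fixy) x_in.
Qed.

(** Cycles are listed against the direction of w because [block_cycle] lowers the
    positions inside an interval. *)
Definition down_cycle (w : {perm I}) (l : seq I) :=
  forall x0 k, (k < size l)%N ->
    w (nth x0 l k) = nth x0 l (if k == 0 then (size l).-1 else k.-1)%N.

(** If the sequences in L are cycles of w, listed downwards, then reading off
    their concatenation transports the block permutation to w. The offset a is
    what the induction on L requires. *)
Lemma block_perm_conj (w : {perm I}) (L : seq (seq I)) x0 a (x : I) :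
  (forall l, l \in L -> down_cycle w l) -> all (ltn 0) (shape L) ->
  (a + sumn (shape L) <= n.+1)%N -> (a <= x < a + sumn (shape L))%N ->
  w (nth x0 (flatten L) (x - a)) = nth x0 (flatten L) (block_perm a (shape L) x - a).
Proof.
elim: L a x => [|l L IH] a x wL /=; first by lia.
case/andP=> l0 L0 le_n x_in; rewrite permM !nth_cat.
have cE := block_cycleE x l0 (leq_trans (leq_add (leqnn a) (leq_addr _ _)) le_n).
have [lt_x|ge_x] := ltnP (x - a) (size l).
  have x_in1 : (a <= x < a + size l)%N by lia.
  rewrite x_in1 in cE.
  rewrite block_perm_out //; [|lia|by rewrite cE; case: ifP; lia].
  rewrite wL ?mem_head // cE; case: (ltnP _ (size l)) => [_|]; last first.
    by case: ifP; lia.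
  by congr (nth _ _ _); do ![case: ifP]; lia.
have -> : block_cycle a (size l) x = x.
  by apply: val_inj; rewrite [LHS]cE; case: ifP => //; lia.
have x_in' : (a + size l <= x < a + size l + sumn (shape L))%N by lia.
have le_n' : (a + size l + sumn (shape L) <= n.+1)%N by lia.
have wL' l' : l' \in L -> down_cycle w l' by move=> l'L; apply: wL; rewrite inE l'L orbT.
rewrite -!subnDA IH //.
by have := block_perm_in L0 le_n' x_in'; case: (ltnP _ (size l)) => //; lia.
Qed.

(** Each entry of a [down_cycle] is the image under w of the next one, whence the
    inverse of w. *)
Lemma down_traject (w : {perm I}) x : down_cycle w (traject w^-1%g x #|porbit w x|).
Proof.
move=> x0 k; rewrite size_traject => lt_k; set m := #|porbit w x| in lt_k *.
have nthE j : (j < m)%N -> nth x0 (traject w^-1%g x m) j = iter j w^-1%g x.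
  by move=> lt_j; rewrite (set_nth_default x) ?size_traject // nth_traject.
rewrite !nthE //; last by case: ifP => _; lia.
case: eqP => [->|/eqP k0] /=; last first.
  by rewrite -[in LHS](prednK (n := k)) ?lt0n //= permKV.
have := iter_porbit w^-1%g x; rewrite porbitV -/m => {1}<-.
by rewrite -[in LHS](prednK (n := m)) //= ?permKV //; lia.
Qed.

(** Arrange the orbits of w so that their sizes are s, and list each of them as
    a trajectory of the inverse of w. The concatenation of these lists enumerates
    all the points, and this enumeration is the conjugating permutation. *)
Lemma cycle_type_conj (w : {perm I}) (s : seq nat) :
  sumn s = n.+1 -> perm_eq (cycle_type w) s ->
  exists f : {perm I}, (w = block_perm 0 s ^ f)%g.
Proof.
move=> sumL; rewrite /cycle_type perm_sort => /perm_eq_map[os pos osE].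
have os_mem c : c \in os -> exists x, c == porbit w x.
  rewrite (perm_mem pos) mem_enum => /imsetP[x _ ->]; by exists x.
pose r (c : {set I}) : I := odflt ord0 [pick x | c == porbit w x].
have rE c : c \in os -> porbit w (r c) = c.
  by move=> /os_mem[x xc]; rewrite /r; case: pickP => [y /eqP->|/(_ x)/negP] //.
pose L := [seq traject w^-1%g (r c) #|c| | c <- os].
have shL : shape L = s.
  rewrite -osE /shape -map_comp; apply: eq_map => c /=; exact: size_traject.
have memL x : x \in flatten L.
  have xo : porbit w x \in os by rewrite (perm_mem pos) mem_enum imset_f.
  apply/flattenP; exists (traject w^-1%g (r (porbit w x)) #|porbit w x|).
    by apply/mapP; exists (porbit w x).
  by have := porbit_traject w^-1%g (r (porbit w x)) x; rewrite porbitV rE // => <-; exact: porbit_id.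
have s0 : all (ltn 0) s.
  rewrite -osE; apply/allP=> _ /mapP[c co ->]; rewrite -(rE c co).
  by apply/card_gt0P; exists (r c); exact: porbit_id.
(* A list of n + 1 entries that contains all the points has no repetition. *)
have uL : uniq (flatten L).
  apply: (@leq_size_uniq _ (enum I)); rewrite ?enum_uniq //.
  by rewrite size_flatten shL sumL size_enum_ord.
pose f (i : I) := nth ord0 (flatten L) i.
have f_inj : injective f.
  move=> i j /eqP; rewrite nth_uniq ?size_flatten ?shL ?sumL ?ltn_ord // => /eqP ij.
  exact: val_inj.
exists (perm f_inj); apply/permP=> y.
have [x ->] : exists x, y = perm f_inj x by exists ((perm f_inj)^-1%g y); rewrite permKV.
rewrite permJ !permE /f.
have := @block_perm_conj w L ord0 0 x; rewrite shL sumL !subn0 add0n leqnn ltn_ord.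
by apply=> // l /mapP[c co ->]; rewrite -{2}(rE c co); exact: down_traject.
Qed.
End BlockPerm.

(** * The action of the canonical elements *)

Section Blam.
Variables (C : numClosedFieldType) (n : nat) (U : clif_supermodule C n.+1) (lam : seq nat).
Local Notation d := (sm_dim U).
Local Notation M := 'M[C]_d.
Local Notation k := (sqrtC 2)^-1.

Definition clif_nat (i : nat) : M := clif_mx U (inord i).

Lemma clif_nat_sq i : clif_nat i * clif_nat i = 1.
Proof. exact: clif_mx_sq. Qed.

Lemma clif_nat_anti i j : (i < n.+1)%N -> (j < n.+1)%N -> i != j ->
  anticomm (clif_nat i) (clif_nat j).
Proof.
move=> lt_i lt_j ij; apply: clif_mx_anti; apply: contraNneq ij => eq_ij.
by rewrite -(inordK lt_i) -(inordK lt_j) eq_ij.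
Qed.

(** Such factorizations multiply ([acts_asM]), which reduces the canonical
    elements to the generators, and they give the trace of e as tr X * chi(g). *)
Definition acts_as (e : spinB C n.+1) (X : M) (g : 'S_n.+1) :=
  Blam U lam e = X *t specht_repr C n.+1 lam g :> 'M_(d * \rank (specht_mx C n.+1 lam)).

Lemma acts_asM e X g e' X' g' :
  acts_as e X g -> acts_as e' X' g' -> acts_as (e * e') (X * X') (g * g')%g.
Proof.
by rewrite /acts_as => eE e'E; rewrite rmorphM eE e'E repr_mxM ?inE // -tensmx_mul.
Qed.

Lemma acts_as1 : acts_as 1 1 1%g.
Proof.
rewrite /acts_as rmorph1 repr_mx1; apply/matrixP=> i j.
case: (mxtens_indexP i) => i0 i1; case: (mxtens_indexP j) => j0 j1.
rewrite tensmxE !mxE (can_eq (@mxtens_indexK _ _)) xpair_eqE.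
by rewrite -natrM mulnb.
Qed.

Lemma tens_reprE x y : tens_repr (sm_repr U) (grpalg_repr (specht_repr C n.+1 lam))
    (tensl _ x * tensr _ y) =
  (sm_repr U x : M) *t (grpalg_repr (specht_repr C n.+1 lam) y : 'M__) :> 'M_(_ * _).
Proof.
rewrite rmorphM /tensl /tensr !plift_gen.
by rewrite -[LHS]/((_ *t 1%:M) *m (1%:M *t _)) tensmx_mul mulmx1 mul1mx.
Qed.

Lemma Blam_sgen (i : 'I_n.+1) : Blam U lam (sgen C i) =
  tens_repr (sm_repr U) (grpalg_repr (specht_repr C n.+1 lam)) (phiB_gen C i).
Proof. by rewrite -(plift_gen (@phiB_respects C n.+1)). Qed.

Lemma sgen_natE i : (i < n.+1)%N -> sgen_nat C n.+1 i = sgen C (inord i).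
Proof.
move=> lt_i; rewrite /sgen_nat insubT /=; congr sgen.
by apply: val_inj; rewrite /= inordK.
Qed.

Lemma acts_as_gen i : (i.+1 < n.+1)%N ->
  acts_as (sgen_nat C n.+1 i) (root_vec clif_nat k i) (adj n i).
Proof.
move=> lt_i; have ltW := ltnW lt_i.
have eS : ordS (inord i : 'I_n.+1) = inord i.+1.
  by apply: val_inj; rewrite /= !inordK // modn_small.
rewrite /acts_as sgen_natE // Blam_sgen /phiB_gen inordK // lt_i tens_reprE; congr (_ *t _).
  by rewrite rmorphM alg_fun_scalar rmorphB eS; exact: mul_scalar_mx.
by rewrite /grp plift_gen eS.
Qed.

Lemma acts_as_last : acts_as (sgen_nat C n.+1 n) (clif_nat n) 1%g.
Proof.
rewrite /acts_as sgen_natE // Blam_sgen /phiB_gen inordK // ltnn.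
by rewrite plift_gen /= repr_mx1.
Qed.

(** For anticommuting involutions x and y, (x - y) y (x - y) = - 2 x. *)
Lemma root_vec_conj i : (i.+1 < n.+1)%N ->
  root_vec clif_nat k i * clif_nat i.+1 * root_vec clif_nat k i = - clif_nat i.
Proof.
move=> lt_i; have ltW := ltnW lt_i.
have a : clif_nat i * clif_nat i.+1 = - (clif_nat i.+1 * clif_nat i).
  by apply/eqP/clif_nat_anti => //; lia.
have aa := clif_nat_sq i; have bb := clif_nat_sq i.+1.
rewrite /root_vec; move: (clif_nat i) (clif_nat i.+1) a aa bb => x y a aa bb.
rewrite !scale_mulmxl scale_mulmxr scalerA.
have -> : (x - y) * y * (x - y) = - (x *+ 2).
  rewrite mulrBl bb mulrBl mul1r mulrBr -(mulrA x y y) bb mulr1.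
  by rewrite a mulNr -mulrA aa mulr1 opprB mulr2n opprD addrC addrACA subrr add0r.
by rewrite -invfM -expr2 sqrtCK -scaler_nat scalerN scalerA mulVf ?scale1r // pnatr_eq0.
Qed.

(** The transpositions of t_i b_(i+1) t_i cancel, and each of the n - i
    conjugations contributes a sign (here n is the last index). *)
Lemma acts_as_bgen i : (i < n.+1)%N ->
  acts_as (bgen C n.+1 i) ((-1) ^+ (n - i) *: clif_nat i) 1%g.
Proof.
move=> lt_i; rewrite /bgen /=.
have : (i + (n - i) = n)%N by lia.
move: (n - i)%N {lt_i} => m; elim: m i => [|m IH] i /= im.
  by have -> : i = n; [lia | rewrite scale1r; exact: acts_as_last].
have lt_i : (i.+1 < n.+1)%N by lia.
have := acts_asM (acts_asM (acts_as_gen lt_i) (IH i.+1 _)) (acts_as_gen lt_i).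
rewrite mulg1 /adj tperm2 (scale_mulmxr ((-1) ^+ m)) (scale_mulmxl ((-1) ^+ m)) root_vec_conj //.
by rewrite exprS mulN1r scaleNr scalerN; apply; lia.
Qed.

Lemma acts_as_pos a m : (0 < m)%N -> (a + m <= n.+1)%N ->
  acts_as (pos_cycle C n.+1 a m) (pos_word clif_nat k a m) (block_cycle n a m).
Proof.
case: m => // m _; rewrite /pos_cycle /pos_word /block_cycle addnS /=.
elim: m => [|m IH] am; first by rewrite !big_geq ?addn0 //; exact: acts_as1.
rewrite addnS !big_nat_recr ?leq_addr //=; apply: acts_asM; first by apply: IH; lia.
by apply: acts_as_gen; lia.
Qed.

Lemma acts_as_neg a m : (0 < m)%N -> (a + m <= n.+1)%N -> ~~ odd (n.+1 - (a + m)) ->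
  acts_as (neg_cycle C n.+1 a m) (neg_word clif_nat k a m) (block_cycle n a m).
Proof.
move=> m0 am ev; rewrite /neg_cycle /neg_word -[block_cycle _ _ _]mulg1.
apply: acts_asM; first exact: acts_as_pos.
have := @acts_as_bgen (a + m).-1; have -> : (n - (a + m).-1 = n.+1 - (a + m))%N by lia.
by rewrite -signr_odd (negPf ev) scale1r; apply; lia.
Qed.

Lemma acts_as_pos_word a s : all (ltn 0) s -> (a + sumn s <= n.+1)%N ->
  acts_as (cycle_prod (pos_cycle C n.+1) a s)
    (cat_word (pos_word clif_nat k) a s) (block_perm n a s).
Proof.
elim: s a => [|m s IH] a /=; first by move=> _ _; exact: acts_as1.
case/andP=> m0 s0 an; apply: acts_asM; first by apply: acts_as_pos => //; lia.
by apply: IH => //; lia.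
Qed.

(** As the intervals reach the end and have even lengths, the number of indices
    after a negative cycle is even, and the sign of its last factor is 1. *)
Lemma acts_as_neg_word a s : all (fun m => (0 < m)%N && ~~ odd m) s ->
  (a + sumn s = n.+1)%N ->
  acts_as (cycle_prod (neg_cycle C n.+1) a s)
    (cat_word (neg_word clif_nat k) a s) (block_perm n a s).
Proof.
elim: s a => [|m s IH] a /=; first by move=> _ _; exact: acts_as1.
case/andP=> /andP[m0 em] s0 an; apply: acts_asM; last by apply: IH => //; lia.
apply: acts_as_neg => //; first by lia.
have -> : (n.+1 - (a + m) = sumn s)%N by lia.
by elim: s s0 {IH an} => //= p s IH /andP[/andP[_ ep] /IH]; rewrite oddD (negPf ep).
Qed.

Lemma specht_char_conj (w g : 'S_n.+1) :
  specht_char C lam (w ^ g)%g = specht_char C lam w.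
Proof.
rewrite /specht_char conjgE !repr_mxM ?inE // mxtrace_mulC -mulmxA.
by rewrite -repr_mxM ?inE // mulgV repr_mx1 mulmx1.
Qed.

Lemma Blam_char_canonical s s' : all odd s ->
  all (fun m => (0 < m)%N && ~~ odd m) s' -> (sumn s + sumn s' = n.+1)%N ->
  Blam_char U lam (canonical_elt C n.+1 s s') =
  (\prod_(m <- s ++ s') cycle_weight k m) * d%:R *
    specht_char C lam (block_perm n 0 (s ++ s')).
Proof.
move=> s_odd s_even sn.
have s0 : all (ltn 0) s by apply: sub_all s_odd; case.
rewrite /Blam_char /canonical_elt block_perm_cat add0n.
have sp := @acts_as_pos_word 0 s s0 (leq_trans (leq_addr (sumn s') _) (eq_leq sn)).
rewrite (acts_asM sp (acts_as_neg_word s_even sn)) mxtrace_tens; congr (_ * _).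
by apply: (mxtrace_canonical_word k (fun i _ => clif_nat_sq i) clif_nat_anti) => //;
  rewrite sn.
Qed.
End Blam.

Theorem proposition4p5 (R : realType) (n : nat) (lam alpha beta : seq nat)
    (U : clif_supermodule R[i] n) (s s' : seq nat) (w : 'S_n) :
  (0 < n)%N ->
  is_partition lam -> sumn lam = n ->
  is_partition alpha -> is_partition beta -> (sumn alpha + sumn beta)%N = n ->
  all (fun p => odd p) alpha -> all (fun p => ~~ odd p) beta ->
  simple_supermodule U ->
  perm_eq s alpha -> perm_eq s' beta ->
  cycle_type w = part_union alpha beta ->
  Blam_char U lam (canonical_elt R[i] n s s') =
    (if odd n then sqrtC 2 ^+ (size (part_union alpha beta)).+1
     else sqrtC 2 ^+ size (part_union alpha beta))
    * (-1) ^+ ((n - size alpha)./2) * specht_char R[i] lam w.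
Proof.
case: n U w => // n U w _ _ _ _ /andP[_ beta0] sum_n a_odd b_even simU ps ps' cw.
have s_odd : all odd s by rewrite (perm_all _ ps).
have s_even : all (fun m => (0 < m)%N && ~~ odd m) s'.
  rewrite (perm_all _ ps'); apply/allP=> m mb; rewrite (allP b_even m mb) andbT lt0n.
  by apply: contraNneq beta0 => <-.
have sn : (sumn s + sumn s' = n.+1)%N by rewrite (perm_sumn ps) (perm_sumn ps').
have pss : perm_eq (cycle_type w) (s ++ s').
  by rewrite cw /part_union perm_sort perm_sym perm_cat.
have [f ->] := cycle_type_conj (etrans (sumn_cat _ _) sn) pss.
rewrite specht_char_conj (Blam_char_canonical _ _ s_odd s_even sn); congr (_ * _).
rewrite (simple_supermodule_dim simU) /part_union size_sort size_cat.
rewrite -(perm_size ps) -(perm_size ps').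
have all0 : all (ltn 0) (s ++ s').
  rewrite all_cat (sub_all _ s_odd) /=; last by case.
  by apply: sub_all s_even => m /andP[].
rewrite prod_cycle_weight // count_cat size_cat sumn_cat sn.
rewrite (eqP (etrans (esym (all_count _ _)) s_odd)).
have /eqP -> : count odd s' == 0%N.
  by rewrite eqn0Ngt -has_count -all_predC; apply: sub_all s_even => m /andP[].
rewrite addn0 -mulrA mulrC; congr (_ * _).
have le_n : (size s + size s' <= n.+1)%N.
  rewrite -sn -sumn_cat -size_cat; elim: (s ++ s') all0 => //= m t IH /andP[m0 /IH]; lia.
have -> : (2 ^ uphalf n.+1)%:R = sqrtC 2 ^+ (n.+1 + odd n.+1) :> R[i].
  have -> : (n.+1 + odd n.+1 = 2 * uphalf n.+1)%N by rewrite mul2n; lia.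
  by rewrite exprM sqrtCK natrX.
have -> : (if odd n.+1 then sqrtC 2 ^+ (size s + size s').+1
           else sqrtC 2 ^+ (size s + size s')) =
          sqrtC 2 ^+ (size s + size s' + odd n.+1) :> R[i].
  by case: odd; rewrite ?addn1 ?addn0.
have k0 : sqrtC 2 ^+ (n.+1 - (size s + size s')) != 0 :> R[i].
  by rewrite expf_neq0 // sqrtC_eq0 pnatr_eq0.
apply: (mulIf k0); rewrite mulrC exprVn mulrA divff // mul1r -exprD.
by congr (_ ^+ _); lia.
Qed.
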